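(* Let $K$ be a finite field and $R$ a finite dimensional $K$-algebra. Let $\{M_n\}_{n=1}^\infty$ be a sequence of nonzero finitely generated left $R$-modules which is hyperfinite and convergent, and put $\mathrm{rk}_{\mathcal M}(A)=\lim_{n\to\infty}\mathrm{rk}_{M_n}(A)$ for every $A\in\mathrm{Mat}(R)$. Then there exists a representation (unital $K$-algebra homomorphism) $\rho:R\to M_K$ such that $\mathrm{rk}_\rho=\mathrm{rk}_{\mathcal M}$.
   Context: $\mathrm{Mat}(R)$ is the set of all finite rectangular matrices over $R$. For a nonzero finitely generated $R$-module $M$ and $A\in\mathrm{Mat}_{k\times l}(R)$, $\mathrm{rk}_M(A)$ is the $K$-rank of the linear map $M^l\to M^k$ given by $A$, divided by $\dim_K(M)$. The sequence $\{M_n\}$ is convergent if $\lim_{n\to\infty}\mathrm{rk}_{M_n}(A)$ exists for every $A\in\mathrm{Mat}(R)$. A family $\{M_n\}$ of finitely generated $R$-modules is hyperfinite if for any $\epsilon>0$ there is a finite family $N_1,\dots,N_t$ of finitely generated $R$-modules such that for every $n$ there exist a submodule $P_n\subset M_n$ with $\dim_K(P_n)\ge(1-\epsilon)\dim_K(M_n)$ and non-negative integers $\alpha_1,\dots,\alpha_t$ with $P_n\cong\bigoplus_{i=1}^tN_i^{\alpha_i}$. $M_K$ (von Neumann's continuous algebra): consider the diagonal embeddings $K\to\mathrm{Mat}_{2\times2}(K)\to\mathrm{Mat}_{4\times4}(K)\to\mathrm{Mat}_{8\times8}(K)\to\cdots$, $A\mapsto\begin{pmatrix}A&0\\0&A\end{pmatrix}$,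 which preserve the normalized rank $\mathrm{rank}(A)/2^k$ on $\mathrm{Mat}_{2^k\times2^k}(K)$. The direct limit $\varinjlim\mathrm{Mat}_{2^k\times2^k}(K)$ thus carries a rank function, and $M_K$ is the completion of it with respect to the metric $d(A,B)=\mathrm{rank}(A-B)$. The algebra operations and the rank function (also on rectangular matrices) extend to $M_K$; this rank is denoted $\mathrm{rank}_{M_K}$. For a homomorphism $\rho:R\to M_K$, $\mathrm{rk}_\rho(A)=\mathrm{rank}_{M_K}(\tilde\rho(A))$, where $\tilde\rho$ is $\rho$ applied entrywise to the matrix $A$. *)

(* Defs.v *)
From HB Require Import structures.
From mathcomp Require Import all_boot all_order all_algebra.
From mathcomp Require Import falgebra generic_quotient ring_quotient.
From mathcomp Require Import boolp classical_sets functions reals topology.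
From mathcomp Require Import normedtype sequences.

Set Implicit Arguments.
Unset Strict Implicit.
Unset Printing Implicit Defensive.

Import Order.TTheory GRing.Theory Num.Theory.
Import numFieldNormedType.Exports.

Local Open Scope classical_set_scope.
Local Open Scope ring_scope.
Local Open Scope quotient_scope.

(* Dependent products of modules; over a finite index type, direct sums. *)
Definition dprod (A : pzRingType) (I : Type) (V : I -> lmodType A) : Type :=
  forall i, V i.

Section DProd.
Variables (A : pzRingType) (I : Type) (V : I -> lmodType A).
Implicit Types f g h : dprod V.

HB.instance Definition _ := gen_eqMixin (dprod V).
HB.instance Definition _ := gen_choiceMixin (dprod V).

Let add f g : dprod V := fun i => f i + g i.
Let opp f : dprod V := fun i => - f i.
Let zero : dprod V := fun=> 0.
Let scale a f : dprod V := fun i => a *: f i.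

Fact dprod_addA : associative add.
Proof. by move=> f g h; apply: functional_extensionality_dep => i; apply: addrA. Qed.
Fact dprod_addC : commutative add.
Proof. by move=> f g; apply: functional_extensionality_dep => i; apply: addrC. Qed.
Fact dprod_add0 : left_id zero add.
Proof. by move=> f; apply: functional_extensionality_dep => i; apply: add0r. Qed.
Fact dprod_addN : left_inverse zero opp add.
Proof. by move=> f; apply: functional_extensionality_dep => i; apply: addNr. Qed.

HB.instance Definition _ :=
  GRing.isZmodule.Build (dprod V) dprod_addA dprod_addC dprod_add0 dprod_addN.

Fact dprod_scaleA a b f : scale a (scale b f) = scale (a * b) f.
Proof. by apply: functional_extensionality_dep => i; apply: scalerA. Qed.
Fact dprod_scale1 : left_id 1 scale.
Proof. by move=> f; apply: functional_extensionality_dep => i; apply: scale1r. Qed.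
Fact dprod_scaleDr : right_distributive scale +%R.
Proof. by move=> a f g; apply: functional_extensionality_dep => i; apply: scalerDr. Qed.
Fact dprod_scaleDl f : {morph scale^~ f : a b / a + b}.
Proof. by move=> a b; apply: functional_extensionality_dep => i; apply: scalerDl. Qed.

HB.instance Definition _ := GRing.Zmodule_isLmodule.Build A (dprod V)
  dprod_scaleA dprod_scale1 dprod_scaleDr dprod_scaleDl.

End DProd.

Section Dimension.
Variables (K : fieldType) (V : lmodType K).

Definition has_dim (S : set V) (d : nat) : Prop :=
  exists b : 'I_d -> V,
    set_bij [set: 'rV[K]_d] S (fun c => \sum_(i < d) c 0 i *: b i).

(* The dimension of a subspace [S]; the default value 0 is only taken when [S]
   has no finite basis. *)
Definition vdim (S : set V) : nat := xget 0%N (has_dim S).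

End Dimension.

Definition over (K : fieldType) (R : algType K) (M : lmodType R) : Type := M.

Section RestrictScalars.
Variables (K : fieldType) (R : algType K) (M : lmodType R).

HB.instance Definition _ := GRing.Zmodule.on (over M).

Let scale (k : K) (x : over M) : over M := (k%:A : R) *: (x : M).

Fact over_scaleA a b x : scale a (scale b x) = scale (a * b) x.
Proof. by rewrite /scale scalerA -scalerAl mul1r scalerA. Qed.
Fact over_scale1 : left_id 1 scale.
Proof. by move=> x; rewrite /scale !scale1r. Qed.
Fact over_scaleDr : right_distributive scale +%R.
Proof. by move=> a x y; apply: scalerDr. Qed.
Fact over_scaleDl x : {morph scale^~ x : a b / a + b}.
Proof. by move=> a b; rewrite /scale scalerDl; apply: scalerDl. Qed.

HB.instance Definition _ := GRing.Zmodule_isLmodule.Build K (over M)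
  over_scaleA over_scale1 over_scaleDr over_scaleDl.

End RestrictScalars.

Section Modules.
Variables (K : fieldType) (R : algType K).

Definition finitely_generated (M : lmodType R) : Prop :=
  exists (n : nat) (g : 'I_n -> M), forall x : M,
    exists c : 'I_n -> R, x = \sum_(i < n) c i *: g i.

Definition nonzero_module (M : lmodType R) : Prop := exists x : M, x != 0.

Definition submodule (M : lmodType R) (P : set M) : Prop :=
  P 0 /\ forall (a : R) x y, P x -> P y -> P (a *: x + y).

Definition dimK (M : lmodType R) (P : set M) : nat := vdim (P : set (over M)).

(* The map [M^l -> M^k] given by a [k * l] matrix over [R]. *)
Definition mx_act (M : lmodType R) k l (A : 'M[R]_(k, l))
    (x : {ffun 'I_l -> M}) : {ffun 'I_k -> M} :=
  [ffun i => \sum_(j < l) A i j *: x j].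

Definition rk_module (F : numFieldType) (M : lmodType R) k l
    (A : 'M[R]_(k, l)) : F :=
  (dimK (range (@mx_act M k l A)))%:R / (dimK [set: M])%:R.

Definition convergent (F : realType) (M : nat -> lmodType R) : Prop :=
  forall k l (A : 'M[R]_(k, l)), cvgn (fun n => rk_module F (M n) A).

Definition rk_lim (F : realType) (M : nat -> lmodType R) k l
    (A : 'M[R]_(k, l)) : F :=
  limn (fun n => rk_module F (M n) A).

(* [N_1^{alpha_1} + ... + N_t^{alpha_t}], an external direct sum. *)
Definition multisum t (N : 'I_t -> lmodType R) (alpha : 'I_t -> nat) :
    lmodType R :=
  dprod (fun i : 'I_t => {ffun 'I_(alpha i) -> N i} : lmodType R).

Definition hyperfinite (F : realType) (M : nat -> lmodType R) : Prop :=
  forall eps : F, 0 < eps ->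
  exists (t : nat) (N : 'I_t -> lmodType R),
    (forall i, finitely_generated (N i)) /\
    forall n, exists P : set (M n),
      [/\ submodule P,
          (1 - eps) * (dimK [set: M n])%:R <= (dimK P)%:R
        & exists (alpha : 'I_t -> nat) (f : {linear multisum N alpha -> M n}),
            set_bij [set: multisum N alpha] P f].

End Modules.

HB.mixin Record isBiIdeal (A : nzRingType) (S : A -> bool) := {
  biideal1 : 1 \in S = false;
  biidealMl : forall a u, u \in S -> a * u \in S;
  biidealMr : forall a u, u \in S -> u * a \in S
}.

#[short(type="biideal")]
HB.structure Definition BiIdeal (A : nzRingType) :=
  {S of GRing.ZmodClosed A S & isBiIdeal A S}.

Definition algquot (K : fieldType) (A : algType K) (I : biideal A) : Type :=
  Quotient.quot I.

Section AlgQuot.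
Variables (K : fieldType) (A : algType K) (I : biideal A).

HB.instance Definition _ := GRing.Zmodule.on (algquot I).
HB.instance Definition _ := EqQuotient.on (algquot I).

Definition aq_pi (x : A) : algquot I := \pi_(Quotient.quot I) x.
Definition aq_repr (x : algquot I) : A := repr (x : Quotient.quot I).

Lemma aq_reprK : cancel aq_repr aq_pi.
Proof. by move=> x; rewrite /aq_pi /aq_repr reprK. Qed.

Lemma aq_piE x y : (aq_pi x = aq_pi y) <-> (x - y \in I).
Proof.
by rewrite (Quotient.idealrBE (I : zmodClosed A)); split => [/eqP|/eqP].
Qed.

Lemma aq_piD x y : aq_pi (x + y) = aq_pi x + aq_pi y.
Proof. by rewrite /aq_pi; apply: (raddfD (\pi_(Quotient.quot I))). Qed.

Lemma aq_pi0 : aq_pi 0 = 0.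
Proof. by rewrite /aq_pi; apply: (raddf0 (\pi_(Quotient.quot I))). Qed.

Let one := aq_pi 1.
Let mul x y := aq_pi (aq_repr x * aq_repr y).
Let scale k x := aq_pi (k *: aq_repr x).

Let reprP x : aq_repr (aq_pi x) - x \in I.
Proof. by apply/aq_piE; rewrite aq_reprK. Qed.

Let mulE x y : mul (aq_pi x) (aq_pi y) = aq_pi (x * y).
Proof.
apply/aq_piE; set a := aq_repr (aq_pi x); set b := aq_repr (aq_pi y).
have -> : a * b - x * y = (a - x) * b + x * (b - y).
  by rewrite mulrBl mulrBr addrA subrK.
by rewrite rpredD //; [apply: biidealMr|apply: biidealMl]; apply: reprP.
Qed.

Let scaleE k x : scale k (aq_pi x) = aq_pi (k *: x).
Proof.
by apply/aq_piE; rewrite -scalerBr -[_ - x]mul1r scalerAl biidealMl ?reprP.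
Qed.

Local Ltac lift := move=> *;
  repeat match goal with x : algquot I |- _ =>
    let y := fresh "y" in
    rewrite -(aq_reprK x); move: (aq_repr x) => y; clear x end;
  rewrite ?(mulE, scaleE, =^~ aq_piD).

Fact aq_mulA : associative mul. Proof. by lift; rewrite mulrA. Qed.
Fact aq_mul1 : left_id one mul. Proof. by rewrite /one; lift; rewrite mul1r. Qed.
Fact aq_1mul : right_id one mul. Proof. by rewrite /one; lift; rewrite mulr1. Qed.
Fact aq_mulDl : left_distributive mul +%R. Proof. by lift; rewrite mulrDl. Qed.
Fact aq_mulDr : right_distributive mul +%R. Proof. by lift; rewrite mulrDr. Qed.
Fact aq_one_neq0 : one != 0.
Proof. by apply/eqP; rewrite -aq_pi0 => /aq_piE; rewrite subr0 biideal1. Qed.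

HB.instance Definition _ := GRing.Zmodule_isNzRing.Build (algquot I)
  aq_mulA aq_mul1 aq_1mul aq_mulDl aq_mulDr aq_one_neq0.

Fact aq_scaleA a b x : scale a (scale b x) = scale (a * b) x.
Proof. by lift; rewrite scalerA. Qed.
Fact aq_scale1 : left_id 1 scale. Proof. by lift; rewrite scale1r. Qed.
Fact aq_scaleDr : right_distributive scale +%R.
Proof. by lift; rewrite scalerDr. Qed.
Fact aq_scaleDl x : {morph scale^~ x : a b / a + b}.
Proof. by lift; rewrite scalerDl. Qed.

HB.instance Definition _ := GRing.Zmodule_isLmodule.Build K (algquot I)
  aq_scaleA aq_scale1 aq_scaleDr aq_scaleDl.

Fact aq_scaleAl a (x y : algquot I) : a *: (x * y) = (a *: x) * y.
Proof.
rewrite -[a *: _]/(scale _ _) -[a *: _]/(scale _ _) -![_ * _]/(mul _ _).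
by move: x y; lift; rewrite scalerAl.
Qed.

HB.instance Definition _ :=
  GRing.Lmodule_isLalgebra.Build K (algquot I) aq_scaleAl.

Fact aq_scaleAr a (x y : algquot I) : a *: (x * y) = x * (a *: y).
Proof.
rewrite -[a *: _]/(scale _ _) -[a *: _]/(scale _ _) -![_ * _]/(mul _ _).
by move: x y; lift; rewrite scalerAr.
Qed.

HB.instance Definition _ :=
  GRing.Lalgebra_isAlgebra.Build K (algquot I) aq_scaleAr.

Lemma aq_piM x y : aq_pi (x * y) = aq_pi x * aq_pi y.
Proof. by rewrite -mulE. Qed.
Lemma aq_pi1 : aq_pi 1 = 1. Proof. by []. Qed.
Lemma aq_piZ k x : aq_pi (k *: x) = k *: aq_pi x.
Proof. by rewrite -scaleE. Qed.

End AlgQuot.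

Section Doubling.
Variable K : fieldType.

Fact dbl_size k : (2 ^ k + 2 ^ k = 2 ^ k.+1)%N.
Proof. by rewrite addnn -mul2n expnS. Qed.

Definition dbl k (A : 'M[K]_(2 ^ k)) : 'M[K]_(2 ^ k.+1) :=
  castmx (dbl_size k, dbl_size k) (block_mx A 0 0 A).

Lemma dblD k (A B : 'M[K]_(2 ^ k)) : dbl (A + B) = dbl A + dbl B.
Proof.
rewrite /dbl; case: _ / (dbl_size k); rewrite !castmx_id.
by rewrite add_block_mx !addr0.
Qed.

Lemma dblZ k c (A : 'M[K]_(2 ^ k)) : dbl (c *: A) = c *: dbl A.
Proof.
rewrite /dbl; case: _ / (dbl_size k); rewrite !castmx_id.
by rewrite scale_block_mx !scaler0.
Qed.

Lemma dbl0 k : dbl (0 : 'M[K]_(2 ^ k)) = 0.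
Proof. by rewrite -(scale0r 0) dblZ scale0r. Qed.

Lemma dblM k (A B : 'M[K]_(2 ^ k)) : dbl (A *m B) = dbl A *m dbl B.
Proof.
rewrite /dbl; case: _ / (dbl_size k); rewrite !castmx_id.
by rewrite mulmx_block !mulmx0 !mul0mx !addr0 !add0r.
Qed.

Lemma dbl1 k : dbl (1%:M : 'M[K]_(2 ^ k)) = 1%:M.
Proof.
rewrite /dbl; case: _ / (dbl_size k); rewrite !castmx_id.
by rewrite -scalar_mx_block.
Qed.

Lemma mxrank_dbl k (A : 'M[K]_(2 ^ k)) : \rank (dbl A) = (2 * \rank A)%N.
Proof.
rewrite /dbl; case: _ / (dbl_size k); rewrite !castmx_id.
by rewrite rank_diag_block_mx addnn mul2n.
Qed.

End Doubling.

Definition stages (K : fieldType) : Type :=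
  dprod (fun k => 'M[K]_(2 ^ k) : lmodType K).

Section Stages.
Variable K : fieldType.

HB.instance Definition _ := GRing.Lmodule.on (stages K).

Let one : stages K := fun=> 1%:M.
Let mul (a b : stages K) : stages K := fun k => a k *m b k.

Fact stages_mulA : associative mul.
Proof. by move=> a b c; apply: functional_extensionality_dep => k; apply: mulmxA. Qed.
Fact stages_mul1 : left_id one mul.
Proof. by move=> a; apply: functional_extensionality_dep => k; apply: mul1mx. Qed.
Fact stages_1mul : right_id one mul.
Proof. by move=> a; apply: functional_extensionality_dep => k; apply: mulmx1. Qed.
Fact stages_mulDl : left_distributive mul +%R.
Proof. by move=> a b c; apply: functional_extensionality_dep => k; apply: mulmxDl. Qed.
Fact stages_mulDr : right_distributive mul +%R.
Proof. by move=> a b c; apply: functional_extensionality_dep => k; apply: mulmxDr. Qed.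

Lemma mx1_pow_neq0 k : (1%:M : 'M[K]_(2 ^ k)) <> 0.
Proof.
move=> /(congr1 (fun A : 'M_(2 ^ k) => \rank A)); rewrite mxrank1 mxrank0.
by move/eqP; rewrite expn_eq0.
Qed.

Fact stages_one_neq0 : one != 0.
Proof. by apply/eqP => /(congr1 (fun a : stages K => a 0%N)) /mx1_pow_neq0. Qed.

HB.instance Definition _ := GRing.Zmodule_isNzRing.Build (stages K)
  stages_mulA stages_mul1 stages_1mul stages_mulDl stages_mulDr stages_one_neq0.

Fact stages_scaleAl c (a b : stages K) : c *: (a * b) = (c *: a) * b.
Proof. by apply: functional_extensionality_dep => k; apply: scalemxAl. Qed.
HB.instance Definition _ :=
  GRing.Lmodule_isLalgebra.Build K (stages K) stages_scaleAl.

Fact stages_scaleAr c (a b : stages K) : c *: (a * b) = a * (c *: b).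
Proof. by apply: functional_extensionality_dep => k; apply: scalemxAr. Qed.
HB.instance Definition _ :=
  GRing.Lalgebra_isAlgebra.Build K (stages K) stages_scaleAr.

(* The direct limit of the algebras ['M[K]_(2 ^ k)] along [dbl] is realized by
   sequences which follow [dbl] from some stage on, modulo equality from some
   stage on; a matrix of stage [k] is represented by the sequences which take
   that value at [k] and follow [dbl] afterwards. *)
Definition coherent : {pred stages K} :=
  fun a => `[< \forall k \near \oo, a k.+1 = dbl (a k) >].

Lemma coherentP (a : stages K) :
  reflect (\forall k \near \oo, a k.+1 = dbl (a k)) (a \in coherent).
Proof. exact: asboolP. Qed.

Fact coherent_closed : subalg_closed coherent.
Proof.
split=> [|c a b /coherentP Ha /coherentP Hb|a b /coherentP Ha /coherentP Hb].
- by apply/coherentP; near=> k; rewrite dbl1.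
- apply/coherentP; near=> k; rewrite -[RHS]/(dbl (c *: a k + b k)) dblD dblZ.
  by rewrite -[LHS]/(c *: a k.+1 + b k.+1); congr (_ *: _ + _); near: k.
- apply/coherentP; near=> k; rewrite -[RHS]/(dbl (a k *m b k)) dblM.
  by rewrite -[LHS]/(a k.+1 *m b k.+1); congr (_ *m _); near: k.
Unshelve. all: by end_near. Qed.

HB.instance Definition _ := GRing.isSubalgClosed.Build K (stages K) coherent
  coherent_closed.

End Stages.

Definition thread (K : fieldType) : Type := {a : stages K | a \in @coherent K}.

Section DirectLimit.
Variable K : fieldType.

HB.instance Definition _ := SubChoice.on (thread K).
HB.instance Definition _ := [SubChoice_isSubAlgebra of thread K by <:].

Definition ev_zero : {pred thread K} :=
  fun a => `[< \forall k \near \oo, val a k = 0 >].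

Lemma ev_zeroP (a : thread K) :
  reflect (\forall k \near \oo, val a k = 0) (a \in ev_zero).
Proof. exact: asboolP. Qed.

Fact ev_zero_zmod_closed : zmod_closed ev_zero.
Proof.
split=> [|a b /ev_zeroP Ha /ev_zeroP Hb]; first by apply/ev_zeroP; near=> k.
apply/ev_zeroP; near=> k; rewrite -[LHS]/(val a k - val b k).
have -> : val a k = 0 by near: k.
have -> : val b k = 0 by near: k.
by rewrite subr0.
Unshelve. all: by end_near. Qed.
HB.instance Definition _ :=
  GRing.isZmodClosed.Build (thread K) ev_zero ev_zero_zmod_closed.

Fact ev_zero1 : (1 \in ev_zero) = false.
Proof. by apply/negbTE/ev_zeroP => -[N _ /(_ N (leqnn N))] /mx1_pow_neq0. Qed.

Fact ev_zeroMl (a u : thread K) : u \in ev_zero -> a * u \in ev_zero.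
Proof.
move=> /ev_zeroP Hu; apply/ev_zeroP; near=> k.
rewrite -[LHS]/(val a k *m val u k); have -> : val u k = 0 by near: k.
exact: mulmx0.
Unshelve. all: by end_near. Qed.

Fact ev_zeroMr (a u : thread K) : u \in ev_zero -> u * a \in ev_zero.
Proof.
move=> /ev_zeroP Hu; apply/ev_zeroP; near=> k.
rewrite -[LHS]/(val u k *m val a k); have -> : val u k = 0 by near: k.
exact: mul0mx.
Unshelve. all: by end_near. Qed.

HB.instance Definition _ :=
  isBiIdeal.Build (thread K) ev_zero ev_zero1 ev_zeroMl ev_zeroMr.

End DirectLimit.

Definition dirlim (K : fieldType) : Type := algquot (@ev_zero K : biideal _).

Section DirLimRank.
Variable K : fieldType.

HB.instance Definition _ := GRing.Algebra.on (dirlim K).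

(* Representatives of the entries of a matrix over the direct limit, put
   together at stage [k] into one block matrix over [K]. *)
Definition stage_mx m n (A : 'M[dirlim K]_(m, n)) k :
    'M[K]_(\sum_(i < m) 2 ^ k, \sum_(j < n) 2 ^ k) :=
  \mxblock_(i < m, j < n) (val (aq_repr (A i j)) k).

(* The normalized rank: the rank at stage [k] divided by [2 ^ k], which does
   not depend on [k] once [k] is large enough. *)
Definition dl_rank m n (A : 'M[dirlim K]_(m, n)) : rat :=
  xget 0 [set q : rat | \forall k \near \oo,
    (\rank (stage_mx A k))%:R / (2 ^ k)%:R = q].

Definition dl_norm (x : dirlim K) : rat := dl_rank (const_mx x : 'M_1).

Definition dl_dist (x y : dirlim K) : rat := dl_norm (x - y).

Definition dl_pi (a : thread K) : dirlim K := aq_pi (@ev_zero K : biideal _) a.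

Lemma rank_stage_mx1 (x : dirlim K) k :
  \rank (stage_mx (const_mx x : 'M_1) k) = \rank (val (aq_repr x) k).
Proof.
rewrite /stage_mx.
under eq_mxblock do rewrite mxE.
have castE m n m' n' (e : (m = m') * (n = n')) (B : 'M[K]_(m, n)) :
  \rank (castmx e B) = \rank B.
  by case: e B => em en B; case: _ / em; case: _ / en; rewrite castmx_id.
by rewrite [in RHS](mxEmxblock (val (aq_repr x) k)) castE.
Qed.

Lemma thread_rank (a : thread K) :
  exists q : rat, \forall k \near \oo, (\rank (val a k))%:R / (2 ^ k)%:R = q.
Proof.
have /coherentP[N _ aN] := valP a.
exists ((\rank (val a N))%:R / (2 ^ N)%:R); exists N => // k /= Nk.
rewrite -(subnK Nk); elim: (k - N)%N => [//|d <-] /=.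
rewrite addSn (aN (d + N)%N (leq_addl _ _)) mxrank_dbl expnS !natrM invfM.
by rewrite mulrACA divff ?pnatr_eq0 // mul1r.
Qed.

Lemma dl_norm_pi (a : thread K) : \forall k \near \oo,
  dl_norm (dl_pi a) = (\rank (val a k))%:R / (2 ^ k)%:R.
Proof.
have [q Hq] := thread_rank a.
have Hr : \forall k \near \oo, val (aq_repr (dl_pi a)) k = val a k.
  have /aq_piE/ev_zeroP H : dl_pi (aq_repr (dl_pi a)) = dl_pi a.
    exact: aq_reprK.
  by near=> k; apply/eqP; rewrite -subr_eq0; apply/eqP; near: k.
suff -> : dl_norm (dl_pi a) = q by near=> k; apply/esym; near: k.
apply: xget_subset1 => [/=|r r' /= Hr1 Hr2].
  near=> k; rewrite rank_stage_mx1.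
  have -> : val (aq_repr (dl_pi a)) k = val a k by near: k.
  by near: k.
by near \oo => k; rewrite -(near Hr1 k) // -(near Hr2 k).
Unshelve. all: by end_near. Qed.

Let dl_ind (P : dirlim K -> Prop) : (forall a, P (dl_pi a)) -> forall x, P x.
Proof. by move=> H x; rewrite -(aq_reprK x). Qed.

Let ler_rank (a b : nat) k : (a <= b)%N ->
  a%:R / (2 ^ k)%:R <= b%:R / (2 ^ k)%:R :> rat.
Proof. by move=> ab; rewrite ler_wpM2r ?ler_nat // invr_ge0. Qed.

Lemma dl_normD (x y : dirlim K) : dl_norm (x + y) <= dl_norm x + dl_norm y.
Proof.
elim/dl_ind: x => a; elim/dl_ind: y => b; rewrite -[dl_pi a + dl_pi b]aq_piD; near \oo => k.
rewrite (near (dl_norm_pi (a + b)) k) // (near (dl_norm_pi a) k) //.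
rewrite (near (dl_norm_pi b) k) // -mulrDl -natrD ler_rank //.
exact: mxrank_add.
Unshelve. all: by end_near. Qed.

Lemma dl_normMl (x y : dirlim K) : dl_norm (x * y) <= dl_norm x.
Proof.
elim/dl_ind: x => a; elim/dl_ind: y => b; rewrite -[dl_pi a * dl_pi b]aq_piM; near \oo => k.
rewrite (near (dl_norm_pi (a * b)) k) // (near (dl_norm_pi a) k) //.
by rewrite ler_rank //; apply: mxrankM_maxl.
Unshelve. all: by end_near. Qed.

Lemma dl_normMr (x y : dirlim K) : dl_norm (x * y) <= dl_norm y.
Proof.
elim/dl_ind: x => a; elim/dl_ind: y => b; rewrite -[dl_pi a * dl_pi b]aq_piM; near \oo => k.
rewrite (near (dl_norm_pi (a * b)) k) // (near (dl_norm_pi b) k) //.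
by rewrite ler_rank //; apply: mxrankM_maxr.
Unshelve. all: by end_near. Qed.

Lemma dl_normZ c (x : dirlim K) : dl_norm (c *: x) <= dl_norm x.
Proof. by rewrite -[x in c *: x]mul1r scalerAl dl_normMr. Qed.

Lemma dl_norm0 : dl_norm 0 = 0.
Proof.
rewrite -[0 in LHS](aq_pi0 (@ev_zero K : biideal _)); near \oo => k; rewrite (near (dl_norm_pi 0) k) //.
have -> : val (0 : thread K) k = 0 by [].
by rewrite mxrank0 mul0r.
Unshelve. all: by end_near. Qed.

Lemma dl_norm1 : dl_norm 1 = 1.
Proof.
rewrite -[1 in LHS]/(dl_pi 1); near \oo => k; rewrite (near (dl_norm_pi 1) k) //.
have -> : val (1 : thread K) k = 1%:M by [].
rewrite mxrank1 divff //.
by rewrite pnatr_eq0 expn_eq0.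
Unshelve. all: by end_near. Qed.

Lemma dl_normN (x : dirlim K) : dl_norm (- x) = dl_norm x.
Proof.
apply/eqP; rewrite eq_le -{3}(opprK x) -[- x]scaleN1r dl_normZ.
by rewrite -[- (-1 *: x)]scaleN1r dl_normZ.
Qed.

End DirLimRank.

Definition dlseq (K : fieldType) : Type := nat -> dirlim K.

Section DlSeq.
Variable K : fieldType.

HB.instance Definition _ := GRing.NzRing.on (dlseq K).
HB.instance Definition _ := GRing.Lmodule.on (dlseq K).

Fact dlseq_scaleAl c (u v : dlseq K) : c *: (u * v) = (c *: u) * v.
Proof. by apply: funext => n; apply: scalerAl. Qed.
HB.instance Definition _ :=
  GRing.Lmodule_isLalgebra.Build K (dlseq K) dlseq_scaleAl.

Fact dlseq_scaleAr c (u v : dlseq K) : c *: (u * v) = u * (c *: v).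
Proof. by apply: funext => n; apply: scalerAr. Qed.
HB.instance Definition _ :=
  GRing.Lalgebra_isAlgebra.Build K (dlseq K) dlseq_scaleAr.

Definition rank_cauchy : {pred dlseq K} := fun u =>
  `[< forall eps : rat, 0 < eps -> exists N, forall m n : nat,
        (N <= m)%N -> (N <= n)%N -> dl_dist (u m) (u n) < eps >].

Lemma rank_cauchyP (u : dlseq K) :
  reflect (forall eps : rat, 0 < eps -> exists N, forall m n : nat,
             (N <= m)%N -> (N <= n)%N -> dl_dist (u m) (u n) < eps)
          (u \in rank_cauchy).
Proof. exact: asboolP. Qed.

Fact rank_cauchy_closed : subalg_closed rank_cauchy.
Proof.
split=> [|c u v /rank_cauchyP Hu /rank_cauchyP Hv|
          u v /rank_cauchyP Hu /rank_cauchyP Hv]; apply/rank_cauchyP => e e0.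
- by exists 0%N => m n _ _; rewrite /dl_dist subrr dl_norm0.
- have e2 : 0 < e / 2 by rewrite divr_gt0.
  have [N HN] := Hu _ e2; have [N' HN'] := Hv _ e2.
  exists (maxn N N') => m n; rewrite !geq_max => /andP[m1 m2] /andP[n1 n2].
  rewrite /dl_dist -[X in dl_norm X]/(c *: u m + v m - (c *: u n + v n)).
  rewrite opprD addrACA -scalerBr (le_lt_trans (dl_normD _ _)) //.
  rewrite [e]splitr ltrD //; last exact: HN'.
  by rewrite (le_lt_trans (dl_normZ _ _)) //; apply: HN.
- have e2 : 0 < e / 2 by rewrite divr_gt0.
  have [N HN] := Hu _ e2; have [N' HN'] := Hv _ e2.
  exists (maxn N N') => m n; rewrite !geq_max => /andP[m1 m2] /andP[n1 n2].
  rewrite /dl_dist -[X in dl_norm X]/(u m * v m - u n * v n).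
  have -> : u m * v m - u n * v n = (u m - u n) * v m + u n * (v m - v n).
    by rewrite mulrBl mulrBr addrA subrK.
  rewrite (le_lt_trans (dl_normD _ _)) // [e]splitr ltrD //.
    by rewrite (le_lt_trans (dl_normMl _ _)) //; apply: HN.
  by rewrite (le_lt_trans (dl_normMr _ _)) //; apply: HN'.
Qed.
HB.instance Definition _ :=
  GRing.isSubalgClosed.Build K (dlseq K) rank_cauchy rank_cauchy_closed.

End DlSeq.

Definition cauchy_dlseq (K : fieldType) : Type :=
  {u : dlseq K | u \in @rank_cauchy K}.

Section Completion.
Variable K : fieldType.

HB.instance Definition _ := SubChoice.on (cauchy_dlseq K).
HB.instance Definition _ := [SubChoice_isSubAlgebra of cauchy_dlseq K by <:].

Definition rank_null : {pred cauchy_dlseq K} := fun u =>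
  `[< forall eps : rat, 0 < eps -> exists N, forall n : nat,
        (N <= n)%N -> dl_norm (val u n) < eps >].

Lemma rank_nullP (u : cauchy_dlseq K) :
  reflect (forall eps : rat, 0 < eps -> exists N, forall n : nat,
             (N <= n)%N -> dl_norm (val u n) < eps)
          (u \in rank_null).
Proof. exact: asboolP. Qed.

Fact rank_null_zmod_closed : zmod_closed rank_null.
Proof.
split=> [|u v /rank_nullP Hu /rank_nullP Hv]; apply/rank_nullP => e e0.
  by exists 0%N => n _; rewrite -[X in dl_norm X]/0 dl_norm0.
have e2 : 0 < e / 2 by rewrite divr_gt0.
have [N HN] := Hu _ e2; have [N' HN'] := Hv _ e2.
exists (maxn N N') => n; rewrite !geq_max => /andP[n1 n2].
rewrite -[X in dl_norm X]/(val u n - val v n).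
rewrite (le_lt_trans (dl_normD _ _)) // dl_normN [e]splitr ltrD //.
  exact: HN.
exact: HN'.
Qed.
HB.instance Definition _ :=
  GRing.isZmodClosed.Build (cauchy_dlseq K) rank_null rank_null_zmod_closed.

Fact rank_null1 : (1 \in rank_null) = false.
Proof.
apply/negbTE/rank_nullP => /(_ 1 ltr01)[N /(_ N (leqnn N))].
by rewrite -[X in dl_norm X]/1 dl_norm1 ltxx.
Qed.

Fact rank_nullMl (a u : cauchy_dlseq K) : u \in rank_null -> a * u \in rank_null.
Proof.
move=> /rank_nullP Hu; apply/rank_nullP => e /Hu[N HN]; exists N => n /HN.
by apply: le_lt_trans; exact: (dl_normMr (val a n) (val u n)).
Qed.

Fact rank_nullMr (a u : cauchy_dlseq K) : u \in rank_null -> u * a \in rank_null.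
Proof.
move=> /rank_nullP Hu; apply/rank_nullP => e /Hu[N HN]; exists N => n /HN.
by apply: le_lt_trans; exact: (dl_normMl (val u n) (val a n)).
Qed.

HB.instance Definition _ := isBiIdeal.Build (cauchy_dlseq K) rank_null
  rank_null1 rank_nullMl rank_nullMr.

End Completion.

(* Von Neumann's continuous algebra [M_K]: Cauchy sequences of the direct limit
   modulo null sequences. Since [dl_dist] is rational-valued, rational [eps]
   suffice. *)
Definition vN_algebra (K : fieldType) : Type :=
  algquot (@rank_null K : biideal _).

Section VNRank.
Variable K : fieldType.

HB.instance Definition _ := GRing.Algebra.on (vN_algebra K).

(* The rank extended by continuity: the limit of the ranks of the [n]-th
   approximations of the entries. *)
Definition vN_rank (F : realType) m n (A : 'M[vN_algebra K]_(m, n)) : F :=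
  limn (fun s : nat =>
    ratr (dl_rank (\matrix_(i < m, j < n) val (aq_repr (A i j)) s)) : F).

Definition rk_rep (F : realType) (R : algType K)
    (rho : {lrmorphism R -> vN_algebra K}) k l (A : 'M[R]_(k, l)) : F :=
  vN_rank F (map_mx rho A).

End VNRank.

(* Main.v *)
Require Import Defs.
From HB Require Import structures.
From mathcomp Require Import all_boot all_order all_algebra.
From mathcomp Require Import falgebra.
From mathcomp Require Import boolp classical_sets functions reals topology.
From mathcomp Require Import normedtype.
From mathcomp Require Import ring lra.

(* Pass to a subsequence n_j along which, for the hyperfiniteness data at
   precision 2^-j, the proportions dim (N_i^alpha_i) / dim M_n have almost
   converged (pigeonhole). Filling K^(2^k), for k large, with copies of M_(n_j)
   and zero padding gives an almost unital homomorphism R -> Mat_(2^k)(K) whose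
   normalized ranks are close to those of M_(n_j). Since M_(n_j) and M_(n_(j+1))
   contain almost the same proportion of every N_i, the paddings of both contain
   isomorphic submodules of codimension at most 3 * 2^-j * 2^k; extending the
   isomorphism to K^(2^k) and conjugating by it makes the two homomorphisms
   3 * 2^-j-close in rank. The resulting sequence of homomorphisms into the direct
   limit is Cauchy, and its limit is the required representation. *)

Set Implicit Arguments.
Unset Strict Implicit.
Unset Printing Implicit Defensive.

Import Order.TTheory GRing.Theory Num.Theory.
Import numFieldNormedType.Exports.

Local Open Scope classical_set_scope.
Local Open Scope ring_scope.

(** * Dimensions *)

Section Dimension.
Variables (K : fieldType) (V : lmodType K).
Implicit Types (S : set V) (d : nat).

(** The coefficient matrix of a basis in terms of [v] has trivial left kernel, so its rank [d] is at
    most the number of its columns. *)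
Lemma has_dim_le S d (T : finType) (v : T -> V) :
  has_dim S d -> (forall x, S x -> exists c : T -> K, x = \sum_t c t *: v t) ->
  (d <= #|T|)%N.
Proof.
move=> [b [bS binj _]] spanv.
have /choice[G GE] : forall i, exists c : T -> K, b i = \sum_t c t *: v t.
  move=> i; apply: spanv; have -> : b i = \sum_j (delta_mx 0 i : 'rV[K]_d) 0 j *: b j.
    rewrite (bigD1 i) //= mxE !eqxx scale1r big1 ?addr0 // => j ji.
    by rewrite mxE (negbTE ji) andbF scale0r.
  exact: bS.
pose A : 'M[K]_(d, #|T|) := \matrix_(i, j) G i (enum_val j).
suff /eqnP <- : row_free A by apply: rank_leq_col.
apply: inj_row_free => u uA; apply: binj; rewrite ?inE //.
under [RHS]eq_bigr do rewrite mxE scale0r.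
rewrite [RHS]big1_eq; under eq_bigr do rewrite GE scaler_sumr.
rewrite exchange_big big1 // => t _.
under eq_bigr do rewrite scalerA.
rewrite -scaler_suml; have /rowP/(_ (enum_rank t)) := uA.
by rewrite !mxE; under eq_bigr do rewrite mxE enum_rankK; move=> ->; rewrite scale0r.
Qed.

Lemma has_dim_inj S d d' : has_dim S d -> has_dim S d' -> d = d'.
Proof.
have le e e' : has_dim S e -> has_dim S e' -> (e <= e')%N.
  move=> He [b [_ _ bsurj]]; rewrite -[e']card_ord; apply: (has_dim_le (v := b) He).
  by move=> x /bsurj[c _ <-]; exists (c 0).
by move=> H H'; apply/eqP; rewrite eqn_leq !le.
Qed.

Lemma vdim_eq S d : has_dim S d -> vdim S = d.
Proof.
move=> H; apply: xget_subset1 => // e e' He He'; exact: has_dim_inj He He'.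
Qed.

(** If [S] has no finite basis, [vdim] takes its default value 0 and the bound is trivial; [v] may
    leave [S]. *)
Lemma vdim_le S (T : finType) (v : T -> V) :
  (forall x, S x -> exists c : T -> K, x = \sum_t c t *: v t) ->
  (vdim S <= #|T|)%N.
Proof.
move=> spanv; rewrite /vdim; by case: xgetP => [d _ /has_dim_le/(_ spanv)//|//].
Qed.

(** A spanning family of least size is a basis: a nontrivial relation would allow one vector to be
    dropped. *)
Lemma has_dim_span m (v : 'I_m -> V) :
  (forall x, exists c : 'I_m -> K, x = \sum_i c i *: v i) ->
  exists d, has_dim [set: V] d.
Proof.
move=> spanv.
pose P d := `[< exists b : 'I_d -> V,
  forall x, exists c : 'I_d -> K, x = \sum_i c i *: b i >].
have exP : exists d, P d by exists m; apply/asboolP; exists v.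
case: (ex_minnP exP) => -[|d] /asboolP[b bspan] dmin.
  exists 0%N, b; split => // [u u' _ _ _|x _]; first by apply/rowP => -[].
  by have [c ->] := bspan x; exists 0; rewrite // !big_ord0.
exists d.+1, b; split => // [|x _]; last first.
  have [c ->] := bspan x; exists (\row_i c i) => //.
  by apply: eq_bigr => i _; rewrite mxE.
suff inj0 (u : 'rV[K]_d.+1) : \sum_i u 0 i *: b i = 0 -> u = 0.
  move=> u u' _ _ uu'; apply/eqP; rewrite -subr_eq0; apply/eqP/inj0.
  under eq_bigr do rewrite !mxE scalerBl.
  by rewrite sumrB; apply/eqP; rewrite subr_eq0; apply/eqP.
move=> ub; apply/rowP => i; rewrite [RHS]mxE; apply: contrapT => /eqP ui.
suff /dmin : P d by rewrite ltnn.
apply/asboolP; exists (fun j => b (lift i j)) => x.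
(* Subtracting the multiple [c i / u 0 i] of the relation [ub] cancels the coefficient of [b i]. *)
have [c ->] := bspan x; exists (fun j => c (lift i j) - c i / u 0 i * u 0 (lift i j)).
have -> : \sum_j c j *: b j = \sum_j (c j - c i / u 0 i * u 0 j) *: b j.
  under [RHS]eq_bigr do rewrite scalerBl -scalerA.
  by rewrite sumrB -scaler_sumr ub scaler0 subr0.
by rewrite (bigD1_ord i) //= divfK // subrr scale0r add0r.
Qed.

End Dimension.

(** * Ranks of block matrices *)

Section BlockRank.
Variable K : fieldType.

Definition blk k l m n (F : 'I_k -> 'I_l -> 'M[K]_(m, n)) :
    'M[K]_(\sum_(i < k) m, \sum_(j < l) n) :=
  \mxblock_(i < k, j < l) F i j.

Lemma eq_blk k l m n (F F' : 'I_k -> 'I_l -> 'M[K]_(m, n)) :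
  (forall i j, F i j = F' i j) -> blk F = blk F'.
Proof. exact: eq_mxblock. Qed.

Lemma blkD k l m n (F F' : 'I_k -> 'I_l -> 'M[K]_(m, n)) :
  blk (fun i j => F i j + F' i j) = blk F + blk F'.
Proof. by rewrite /blk -mxblockD. Qed.

Lemma tr_blk k l m n (F : 'I_k -> 'I_l -> 'M[K]_(m, n)) :
  (blk F)^T = blk (fun j i => (F i j)^T).
Proof. exact: tr_mxblock. Qed.

(** The Kronecker product of the identity matrix with [B]: multiplying by it multiplies every block
    by [B]. *)
Definition sdiag k m n (B : 'M[K]_(m, n)) := blk (fun i j : 'I_k => (i == j)%:R *: B).

Lemma sdiag_blk k l m n p (B : 'M[K]_(m, n)) (F : 'I_k -> 'I_l -> 'M_(n, p)) :
  sdiag k B *m blk F = blk (fun i j => B *m F i j).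
Proof.
rewrite /sdiag /blk mul_mxblock; apply: eq_mxblock => i j.
rewrite (bigD1 i) //= eqxx scale1r big1 ?addr0 // => h hi.
by rewrite eq_sym (negbTE hi) scale0r mul0mx.
Qed.

Lemma blk_sdiag k l m n p (B : 'M[K]_(n, p)) (F : 'I_k -> 'I_l -> 'M_(m, n)) :
  blk F *m sdiag l B = blk (fun i j => F i j *m B).
Proof.
rewrite /sdiag /blk mul_mxblock; apply: eq_mxblock => i j.
rewrite (bigD1 j) //= eqxx scale1r big1 ?addr0 // => h hj.
by rewrite (negbTE hj) scale0r mulmx0.
Qed.

Lemma sdiagM k m n p (A : 'M[K]_(m, n)) (B : 'M_(n, p)) :
  sdiag k A *m sdiag k B = sdiag k (A *m B).
Proof. by rewrite sdiag_blk; apply: eq_blk => i j; rewrite scalemxAr. Qed.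

Lemma sdiag1 k n : sdiag k (1%:M : 'M[K]_n) = 1%:M.
Proof.
rewrite -(mxdiagZ 1) /mxdiag /sdiag; apply: eq_mxblock => i j.
by rewrite conform_mx_id; case: eqP; rewrite (scale0r, scale1r).
Qed.

Lemma sdiag0 k m n : sdiag k (0 : 'M[K]_(m, n)) = 0.
Proof.
rewrite /sdiag -[RHS]mxblock0; apply: eq_mxblock => i j; exact: scaler0.
Qed.

(** Blockwise conjugation is multiplication by two matrices [sdiag], which cannot raise the rank;
    conjugating back gives the converse inequality. *)
Lemma rank_blk_conj k l n (g : 'M[K]_n) (F : 'I_k -> 'I_l -> 'M_n) :
  g \in unitmx ->
  \rank (blk (fun i j => g *m F i j *m invmx g)) = \rank (blk F).
Proof.
move=> gU.
have le h h' (G : 'I_k -> 'I_l -> 'M_n) :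
    (\rank (blk (fun i j => h *m G i j *m h')) <= \rank (blk G))%N.
  rewrite -blk_sdiag -sdiag_blk.
  by rewrite (leq_trans (mxrankM_maxl _ _)) ?mxrankM_maxr.
apply/eqP; rewrite eqn_leq le /=.
have /eq_blk {1}-> : forall i j, F i j = invmx g *m (g *m F i j *m invmx g) *m g.
  by move=> i j; rewrite -mulmxA mulmxKV // mulKmx.
exact: le.
Qed.

Lemma rank_mulmx_split k l m n (U : 'M[K]_(m, k)) (U' : 'M[K]_(k, m))
  (W : 'M[K]_(l, n)) (W' : 'M[K]_(n, l)) (D : 'M_(k, l)) :
  U' *m U = 1%:M -> W *m W' = 1%:M -> \rank (U *m D *m W) = \rank D.
Proof.
move=> U1 W1; apply/eqP; rewrite eqn_leq (leq_trans (mxrankM_maxl _ _)) ?mxrankM_maxr //=.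
have {1}-> : D = U' *m (U *m D *m W) *m W'.
  by rewrite !mulmxA U1 mul1mx -mulmxA W1 mulmx1.
by rewrite (leq_trans (mxrankM_maxl _ _)) ?mxrankM_maxr.
Qed.

(** Regrouping the coordinates, first those of all [F] blocks and then those of all [F'] blocks,
    turns the matrix into a block diagonal one; [U] and [W] are the regroupings. *)
Lemma rank_blk_block k l n n' (F : 'I_k -> 'I_l -> 'M[K]_n)
    (F' : 'I_k -> 'I_l -> 'M_n') :
  \rank (blk (fun i j => block_mx (F i j) 0 0 (F' i j))) =
  (\rank (blk F) + \rank (blk F'))%N.
Proof.
pose U p := row_mx (sdiag p (col_mx 1%:M 0 : 'M[K]_(n + n', n)))
                   (sdiag p (col_mx 0 1%:M : 'M[K]_(n + n', n'))).
pose W p := col_mx (sdiag p (row_mx 1%:M 0 : 'M[K]_(n, n + n')))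
                   (sdiag p (row_mx 0 1%:M : 'M[K]_(n', n + n'))).
have WU p : W p *m U p = 1%:M.
  rewrite mul_col_row !sdiagM !mul_row_col !mulmx1 !mulmx0 !addr0 !add0r.
  by rewrite !sdiag0 !sdiag1 -scalar_mx_block.
rewrite -rank_diag_block_mx -(rank_mulmx_split _ (WU k) (WU l)); congr (\rank _).
rewrite mul_row_block !mulmx0 addr0 add0r mul_row_col !sdiag_blk !blk_sdiag -blkD.
apply: eq_blk => i j; rewrite !mul_col_mx !mul1mx !mul0mx !mul_mx_row.
by rewrite !mulmx1 !mulmx0 add_col_mx addr0 add0r block_mxEv.
Qed.

Lemma rank_mxcol_le k m n (C : 'I_k -> 'M[K]_(m, n)) :
  (\rank (\mxcol_i C i) <= \sum_i \rank (C i))%N.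
Proof.
rewrite eqmx_col (leq_trans (mxrank_sum_leqif _)) //=.
by apply: eq_leq; apply: eq_bigr => i _; rewrite mxrank_gen.
Qed.

Lemma rank_blk_le k l m n (F : 'I_k -> 'I_l -> 'M[K]_(m, n)) :
  (\rank (blk F) <= \sum_i \sum_j \rank (F i j))%N.
Proof.
rewrite /blk mxblockEv (leq_trans (rank_mxcol_le _)) //; apply: leq_sum => i _.
rewrite -mxrank_tr tr_mxrow (leq_trans (rank_mxcol_le _)) //.
by apply: leq_sum => j _; rewrite mxrank_tr.
Qed.

End BlockRank.

(** * Matrix families filled with copies of finitely many types *)

Section Frames.
Variables (K : fieldType) (R : Type).

(* The row space K^d contains a copy of the direct sum of the (Y i)^(beta i):
   each [v i a] with [a < beta i] embeds [Y i], and the sum is direct. *)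
Definition frame d (X : R -> 'M[K]_d) t (e : 'I_t -> nat)
    (Y : forall i, R -> 'M[K]_(e i)) (beta : 'I_t -> nat) : Prop :=
  exists v : forall i, nat -> 'M[K]_(e i, d),
    (forall i a r, (a < beta i)%N -> v i a *m X r = Y i r *m v i a) /\
    (forall c : forall i, nat -> 'rV[K]_(e i),
      \sum_i \sum_(a < beta i) c i a *m v i a = 0 ->
      forall i a, (a < beta i)%N -> c i a = 0).

Lemma frame0 d (X : R -> 'M[K]_d) t e (Y : forall i : 'I_t, R -> 'M[K]_(e i)) :
  frame X Y (fun=> 0%N).
Proof. by exists (fun _ _ => 0). Qed.

Lemma frame_sub d (X : R -> 'M[K]_d) t e (Y : forall i : 'I_t, R -> 'M[K]_(e i))
    beta gamma :
  (forall i, (gamma i <= beta i)%N) -> frame X Y beta -> frame X Y gamma.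
Proof.
move=> gb [v [vX vfree]]; exists v; split=> [i a r ag|c c0 i a ag].
  by apply: vX; apply: leq_trans (gb i).
(* Padding the coefficients by zeros gives a relation in the larger frame. *)
pose c' i a := if (a < gamma i)%N then c i a else 0.
rewrite -[LHS]/(c i a) -[c i a](_ : c' i a = _); last by rewrite /c' ag.
apply: (vfree c'); last exact: leq_trans (gb i).
rewrite -[RHS]c0; apply: eq_bigr => j _.
rewrite (big_ord_widen _ (fun a => c j a *m v j a) (gb j)).
rewrite [RHS]big_mkcond /=.
by apply: eq_bigr => b _; rewrite /c'; case: ifP; rewrite ?mul0mx.
Qed.

Lemma frame_block d d' (X : R -> 'M[K]_d) (X' : R -> 'M[K]_d') t e
    (Y : forall i : 'I_t, R -> 'M[K]_(e i)) beta beta' :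
  frame X Y beta -> frame X' Y beta' ->
  frame (fun r => block_mx (X r) 0 0 (X' r)) Y (fun i => beta i + beta' i)%N.
Proof.
move=> [v [vX vfree]] [v' [vX' vfree']].
(* The first [beta i] copies sit in the left summand, the later ones, renumbered from 0, in the
   right summand. *)
exists (fun i a => if (a < beta i)%N then row_mx (v i a) 0
                   else row_mx 0 (v' i (a - beta i)%N)); split.
  move=> i a r ab; case: ltnP => ba; rewrite mul_row_block mul_mx_row.
    by rewrite !mulmx0 mul0mx !addr0 vX.
  by rewrite !mulmx0 mul0mx !add0r vX' // ltn_subLR.
move=> c c0.
have sum_row m (G : 'I_m -> 'rV[K]_d) (G' : 'I_m -> 'rV[K]_d') :
    \sum_i row_mx (G i) (G' i) = row_mx (\sum_i G i) (\sum_i G' i).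
  elim/big_rec3: _ => [|j x y _ _ ->]; first by rewrite row_mx0.
  by rewrite add_row_mx.
have : \sum_i row_mx (\sum_(a < beta i) c i a *m v i a)
         (\sum_(a < beta' i) c i (beta i + a)%N *m v' i a) = 0.
  rewrite -[RHS]c0; apply: eq_bigr => i _; rewrite big_split_ord /=.
  transitivity (row_mx (\sum_(a < beta i) c i a *m v i a) 0 +
      row_mx 0 (\sum_(a < beta' i) c i (beta i + a)%N *m v' i a)).
    by rewrite add_row_mx addr0 add0r.
  congr (_ + _).
    transitivity (\sum_(a < beta i) row_mx (c i a *m v i a) (0 : 'rV[K]_d')).
      by rewrite sum_row big1_eq.
    by apply: eq_bigr => a _; rewrite ltn_ord mul_mx_row mulmx0.
  transitivity (\sum_(a < beta' i) row_mx (0 : 'rV[K]_d) (c i (beta i + a)%N *m v' i a)).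
    by rewrite sum_row big1_eq.
  apply: eq_bigr => a _.
  by rewrite ltnNge leq_addr /= addKn mul_mx_row mulmx0.
rewrite sum_row -row_mx0 => /eq_row_mx[c1 c2] i a ab.
have [ba|ba] := ltnP a (beta i); first exact: vfree c1 i a ba.
have := vfree' (fun i a => c i (beta i + a)%N) c2 i (a - beta i)%N.
by rewrite subnKC // ltn_subLR //; apply.
Qed.

Lemma frame_conj d (X : R -> 'M[K]_d) t e (Y : forall i : 'I_t, R -> 'M[K]_(e i))
    beta (g : 'M_d) :
  g \in unitmx -> frame X Y beta ->
  frame (fun r => g *m X r *m invmx g) Y beta.
Proof.
move=> gU [v [vX vfree]]; exists (fun i a => v i a *m invmx g); split.
  by move=> i a r ab; rewrite !mulmxA mulmxKV // vX.
move=> c c0; apply: vfree; rewrite -[RHS](mul0mx _ g) -[in RHS]c0 mulmx_suml.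
apply: eq_bigr => i _; rewrite mulmx_suml; apply: eq_bigr => a _.
by rewrite !mulmxA mulmxKV.
Qed.

(** Both frames give equally many independent rows, so an invertible [g] carries the first family to
    the second. On the span of the first, both actions are then prescribed by [Y], so their
    difference vanishes there. *)
Lemma frame_common d (X X' : R -> 'M[K]_d) t e
    (Y : forall i : 'I_t, R -> 'M[K]_(e i)) beta :
  frame X Y beta -> frame X' Y beta ->
  exists2 g : 'M_d, g \in unitmx & forall r,
    (\rank (X r - g *m X' r *m invmx g)%R + \sum_i beta i * e i <= d)%N.
Proof.
move=> [v [vX vfree]] [v' [vX' vfree']].
(* An element of [T] selects a type, one of its copies and a row of that copy. *)
pose T := {i : 'I_t & 'I_(beta i) * 'I_(e i)}%type.
have cardT : #|{: T}| = (\sum_i beta i * e i)%N.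
  rewrite card_tagged sumnE big_map big_enum.
  by apply: eq_bigr => i _; rewrite card_prod !card_ord.
pose vec (w : forall i, nat -> 'M[K]_(e i, d)) (p : T) : 'rV[K]_d :=
  row (tagged p).2 (w (tag p) (tagged p).1).
pose stack w : 'M[K]_(#|{: T}|, d) := \matrix_s vec w (enum_val s).
pose pos i (a : 'I_(beta i)) (l : 'I_(e i)) : 'I_#|{: T}| :=
  enum_rank (Tagged (fun i => ('I_(beta i) * 'I_(e i))%type) (a, l)).
have row_stack w i (a : 'I_(beta i)) l :
    row (pos i a l) (stack w) = row l (w i a).
  by rewrite rowK /pos enum_rankK.
have stack_free (w : forall i, nat -> 'M[K]_(e i, d)) :
    (forall c : forall i, nat -> 'rV[K]_(e i),
      \sum_i \sum_(a < beta i) c i a *m w i a = 0 ->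
      forall i a, (a < beta i)%N -> c i a = 0) -> row_free (stack w).
  move=> wfree; apply: inj_row_free => u u0.
  pose c i a : 'rV[K]_(e i) := if insub a is Some a' then
    \row_l u 0 (pos i a' l) else 0.
  have cE i (a : 'I_(beta i)) : c i a = \row_l u 0 (pos i a l).
    by rewrite /c valK.
  have c0 : \sum_i \sum_(a < beta i) c i a *m w i a = 0.
    rewrite -[RHS]u0 mulmx_sum_row (reindex enum_rank) /=; last first.
      by apply: onW_bij; apply: enum_rank_bij.
    rewrite (eq_bigr (fun i => \sum_(p : 'I_(beta i) * 'I_(e i))
      u 0 (pos i p.1 p.2) *: row p.2 (w i p.1))); last first.
      move=> i _; under eq_bigr => a _.
        rewrite cE mulmx_sum_row; under eq_bigr do rewrite mxE. over.
      by rewrite pair_big.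
    rewrite sig_big_dep /=; apply: eq_bigr => -[i [a l]] _ /=.
    by rewrite row_stack.
  apply/rowP => s; rewrite mxE -[s]enum_valK; case: (enum_val s) => i [a l].
  by have /rowP/(_ l) := wfree c c0 i a (ltn_ord a); rewrite cE !mxE.
have fV := stack_free _ vfree; have fV' := stack_free _ vfree'.
(* The pseudoinverse provides a map sending [stack v] to [stack v']; as both have full row rank, it
   can be changed off the row space of [stack v] so as to become invertible. *)
have [g gU gE] : {g | g \in unitmx &
    stack v *m (pinvmx (stack v) *m stack v') = stack v *m g}.
  apply: complete_unitmx; rewrite mulmxA mulmxVp // mul1mx.
  by rewrite (eqnP fV) (eqnP fV').
have {}gE i a : (a < beta i)%N -> v i a *m g = v' i a.
  move=> ab; apply/row_matrixP => l.
  move: gE; rewrite mulmxA mulmxVp // mul1mx => /esym gE.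
  by rewrite row_mul -(row_stack v i (Ordinal ab) l) -row_mul gE row_stack.
(* [X r] and the conjugate of [X' r] agree on the row space of [stack v]. *)
exists g => // r; rewrite addnC -cardT -(eqnP fV); apply: mulmx0_rank_max.
apply/row_matrixP => s; rewrite row0 row_mul -[s]enum_valK.
case: (enum_val s) => i [a l]; rewrite row_stack -row_mul.
rewrite mulmxBr !mulmxA gE // vX // vX' //.
by rewrite -(gE _ _ (ltn_ord a)) mulmxA mulmxK // subrr row0.
Qed.

(* [copies X q S]: up to conjugation, [S] is the direct sum of [q] copies of [X]
   and a zero block. *)
Inductive copies d (X : R -> 'M[K]_d) : nat -> forall n, (R -> 'M[K]_n) -> Prop :=
| copies_zero n : copies X 0 (fun _ => 0 : 'M_n)
| copies_self : copies X 1 X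
| copies_sum q n (S : R -> 'M_n) q' n' (S' : R -> 'M_n') :
    copies X q S -> copies X q' S' ->
    copies X (q + q') (fun r => block_mx (S r) 0 0 (S' r))
| copies_conj q n (S : R -> 'M_n) g : g \in unitmx -> copies X q S ->
    copies X q (fun r => g *m S r *m invmx g)
| copies_cast q n n' (e : n = n') (S : R -> 'M_n) : copies X q S ->
    copies X q (fun r => castmx (e, e) (S r)).

Lemma copies_exist d (X : R -> 'M[K]_d) q n : (q * d <= n)%N ->
  exists S : R -> 'M[K]_n, copies X q S.
Proof.
elim: q n => [|q IH] n qn; first by exists (fun _ => 0); apply: copies_zero.
have dn : (d <= n)%N by rewrite (leq_trans _ qn) // mulSn leq_addr.
have [|S HS] := IH (n - d)%N; first by rewrite leq_subRL // -mulSn.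
exists (fun r => castmx (subnKC dn, subnKC dn) (block_mx (X r) 0 0 (S r))).
exact: copies_cast (copies_sum (copies_self X) HS).
Qed.

Lemma copies_frame d (X : R -> 'M[K]_d) q n (S : R -> 'M_n) t e
    (Y : forall i : 'I_t, R -> 'M[K]_(e i)) beta :
  copies X q S -> frame X Y beta -> frame S Y (fun i => q * beta i)%N.
Proof.
move=> HS HX; elim: HS => {q n S} [n||q n S q' n' S' _ IH _ IH'|q n S g gU _ IH|].
- exact: frame0.
- by have -> : (fun i => 1 * beta i)%N = beta by apply/funext => i; rewrite mul1n.
- have -> : (fun i => (q + q') * beta i)%N = (fun i => q * beta i + q' * beta i)%N.
    by apply/funext => i; rewrite mulnDl.
  exact: frame_block.
- exact: frame_conj.
- by move=> q n n' en S _ IH; case: _ / en.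
Qed.

(** Zero blocks contribute nothing, conjugation preserves the rank of the block matrix, and direct
    sums add ranks. *)
Lemma copies_rank d (X : R -> 'M[K]_d) q n (S : R -> 'M_n) k l
    (F : 'I_k -> 'I_l -> R) :
  copies X q S ->
  \rank (blk (fun i j => S (F i j))) = (q * \rank (blk (fun i j => X (F i j))))%N.
Proof.
elim=> {q n S} [n||q n S q' n' S' _ IH _ IH'|q n S g gU _ IH|q n n' en S _ IH].
- rewrite mul0n -[in RHS](mxrank0 K 0 0); apply/eqP; rewrite mxrank0 mxrank_eq0.
  by apply/eqP; apply: mxblock0.
- by rewrite mul1n.
- by rewrite rank_blk_block IH IH' mulnDl.
- by rewrite rank_blk_conj.
- by case: _ / en; under eq_blk do rewrite castmx_id.
Qed.

End Frames.

(** * Coordinates on finitely generated modules *)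

Section CopiesAlg.
Variables (K : fieldType) (R : algType K) (d : nat) (X : R -> 'M[K]_d).

Lemma copies_linear : (forall c r s, X (c *: r + s) = c *: X r + X s) ->
  forall q n (S : R -> 'M_n), copies X q S ->
  forall c r s, S (c *: r + s) = c *: S r + S s.
Proof.
move=> XL q n S.
elim=> {q n S} [n||q n S q' n' S' _ IH _ IH'|
  q n S g gU _ IH|q n n' en S _ IH] c r s //.
- by rewrite scaler0 addr0.
- by rewrite IH IH' scale_block_mx add_block_mx !scaler0 !addr0.
- by rewrite IH mulmxDr mulmxDl -scalemxAr -scalemxAl.
- by case: _ / en; rewrite !castmx_id.
Qed.

Lemma copies_antimul : (forall r s, X (r * s) = X s *m X r) ->
  forall q n (S : R -> 'M_n), copies X q S ->
  forall r s, S (r * s) = S s *m S r.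
Proof.
move=> XM q n S.
elim=> {q n S} [n||q n S q' n' S' _ IH _ IH'|
  q n S g gU _ IH|q n n' en S _ IH] r s //.
- by rewrite mulmx0.
- by rewrite IH IH' mulmx_block !mulmx0 !mul0mx !addr0 !add0r.
- by rewrite IH !mulmxA mulmxKV.
- by case: _ / en; rewrite !castmx_id.
Qed.

(** Up to conjugation [1 - S 1] is the identity of the zero padding, so its rank is the part of the
    dimension not covered by the copies. *)
Lemma copies_unit : X 1 = 1%:M ->
  forall q n (S : R -> 'M_n), copies X q S ->
  (\rank (1%:M - S 1)%R + q * d = n)%N.
Proof.
move=> X1 q n S.
elim=> {q n S} [n||q n S q' n' S' _ IH _ IH'|
  q n S g gU _ IH|q n n' en S _ IH] //.
- by rewrite subr0 mxrank1 addn0.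
- by rewrite X1 subrr mxrank0 mul1n.
- rewrite (scalar_mx_block n n' 1) opp_block_mx add_block_mx !oppr0 !addr0.
  by rewrite rank_diag_block_mx mulnDl addnACA IH IH'.
- rewrite -[1%:M](mulmxV gU) -{1}[g]mulmx1 -mulmxBl -mulmxBr.
  rewrite mxrankMfree ?row_free_unit ?unitmx_inv // eqmxMfull ?row_full_unit //.
- by case: _ / en; rewrite castmx_id.
Qed.

End CopiesAlg.

(** * Modules in coordinates *)

Section Modules.
Variables (K : fieldType) (R : algType K).

Definition lincomb (M : lmodType R) d (b : 'I_d -> M) (u : 'rV[K]_d) : M :=
  \sum_i (u 0 i)%:A *: b i.

Lemma lincomb_linear (M : lmodType R) d (b : 'I_d -> M) c u v :
  lincomb b (c *: u + v) = c%:A *: lincomb b u + lincomb b v.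
Proof.
rewrite /lincomb scaler_sumr -big_split; apply: eq_bigr => i _ /=.
by rewrite !mxE scalerDl scalerDl scalerA -scalerAl mul1r scalerA.
Qed.

Lemma lincomb0 (M : lmodType R) d (b : 'I_d -> M) : lincomb b 0 = 0.
Proof. by rewrite /lincomb big1 // => i _; rewrite mxE !scale0r. Qed.

Lemma lincomb_sum (M : lmodType R) d (b : 'I_d -> M) I (r : seq I) P
    (u : I -> 'rV[K]_d) :
  lincomb b (\sum_(i <- r | P i) u i) = \sum_(i <- r | P i) lincomb b (u i).
Proof.
elim/big_rec2: _ => [|i y x _ <-]; first exact: lincomb0.
by rewrite -[u i]scale1r lincomb_linear !scale1r.
Qed.

Lemma lincombZ (M : lmodType R) d (b : 'I_d -> M) c u :
  lincomb b (c *: u) = c%:A *: lincomb b u.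
Proof. by rewrite -[c *: u]addr0 lincomb_linear lincomb0 addr0. Qed.

Lemma lincombMmx (M : lmodType R) d d' (b : 'I_d -> M) u (A : 'M[K]_(d', d)) :
  lincomb b (u *m A) = \sum_i (u 0 i)%:A *: lincomb b (row i A).
Proof.
by rewrite mulmx_sum_row lincomb_sum; apply: eq_bigr => i _; apply: lincombZ.
Qed.

(* [X] acts on coordinate row vectors from the right, hence it is an
   antihomomorphism. *)
Definition affords (M : lmodType R) d (b : 'I_d -> M) (X : R -> 'M[K]_d) : Prop :=
  [/\ injective (lincomb b), forall x, exists u, x = lincomb b u
    & forall r u, r *: lincomb b u = lincomb b (u *m X r)].

Section Affords.
Variables (M : lmodType R) (d : nat) (b : 'I_d -> M) (X : R -> 'M[K]_d).
Hypothesis bX : affords b X.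

Let eqX (A B : 'M_d) : (forall u, lincomb b (u *m A) = lincomb b (u *m B)) -> A = B.
Proof.
by case: bX => binj _ _ AB; apply/row_matrixP => i; rewrite !rowE; apply/binj/AB.
Qed.

Lemma affords_linear c r s : X (c *: r + s) = c *: X r + X s.
Proof.
case: bX => _ _ bXE; apply: eqX => u; rewrite -bXE mulmxDr -scalemxAr.
by rewrite lincomb_linear -!bXE scalerDl scalerA -scalerAl mul1r.
Qed.

Lemma affords_antimul r s : X (r * s) = X s *m X r.
Proof.
by case: bX => _ _ bXE; apply: eqX => u; rewrite -bXE mulmxA -!bXE scalerA.
Qed.

Lemma affords_unit : X 1 = 1%:M.
Proof.
by case: bX => _ _ bXE; apply: eqX => u; rewrite -bXE mulmx1 scale1r.
Qed.

Lemma affords_dim : dimK [set: M] = d.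
Proof.
case: bX => binj bsurj _; apply: vdim_eq; exists b; split => //.
  by move=> u u' _ _; apply: binj.
by move=> x _; have [u ->] := bsurj x; exists u.
Qed.

Let vec k (u : 'rV[K]_(\sum_(i < k) d)) : {ffun 'I_k -> M} :=
  [ffun i => lincomb b (submxrow u i)].

Let vec_linear k c (u v : 'rV_(\sum_(i < k) d)) :
  vec (c *: u + v) = c%:A *: vec u + vec v.
Proof.
apply/ffunP => i; rewrite !ffunE -lincomb_linear; congr (lincomb b _).
by apply/rowP => j; rewrite !mxE.
Qed.

Let vecMmx k d' (u : 'rV_d') (A : 'M_(d', \sum_(i < k) d)) :
  vec (u *m A) = \sum_i (u 0 i)%:A *: vec (row i A).
Proof.
have vec0 : vec (0 : 'rV_(\sum_(i < k) d)) = 0.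
  by apply/ffunP => i; rewrite !ffunE submxrow0 lincomb0.
rewrite mulmx_sum_row; elim/big_rec2: _ => [//|i y x _ <-].
by rewrite vec_linear.
Qed.

(** In coordinates the action of [A] is right multiplication by [B], so its range corresponds to the
    row space of [B]. The use of row vectors accounts for the transposed block indices. *)
Lemma affords_rank k l (A : 'M[R]_(k, l)) :
  dimK (range (@mx_act K R M k l A)) =
  \rank (blk (fun (j : 'I_l) (i : 'I_k) => X (A i j))).
Proof.
case: bX => binj bsurj bXE; set B := blk _.
have actE w : mx_act A (vec w) = vec (w *m B).
  apply/ffunP => i; rewrite !ffunE.
  have -> : w *m B = \mxrow_i \sum_j submxrow w j *m X (A i j).
    by rewrite -{1}[w]submxrowK /B /blk mul_mxrow_mxblock.
  rewrite mxrowK lincomb_sum; apply: eq_bigr => j _.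
  by rewrite ffunE bXE.
have vec_inj p : injective (@vec p).
  move=> u u' /ffunP uu'; rewrite -[u]submxrowK -[u']submxrowK.
  by apply: eq_mxrow => i; have := uu' i; rewrite !ffunE => /binj.
apply: vdim_eq; exists (fun j => vec (row j (row_base B))).
have lcE (c : 'rV_(\rank B)) :
    \sum_(i < \rank B) c 0 i *: (vec (row i (row_base B)) : Defs.over _)
    = vec (c *m row_base B) by rewrite vecMmx.
split=> [c _|c c' _ _|x [y _ <-]] /=.
- rewrite lcE; have : (c *m row_base B <= B)%MS.
    by rewrite (submx_trans (submxMl _ _)) // eq_row_base.
  by case/submxP => w ->; exists (vec w).
- by rewrite !lcE => /vec_inj; apply: row_free_inj; apply: row_base_free.
- have [w ->] : exists w, y = vec w.
    have /choice[u uE] : forall i, exists u, y i = lincomb b u by move=> i; apply: bsurj.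
    exists (\mxrow_i u i); apply/ffunP => i; rewrite ffunE uE.
    by rewrite mxrowK.
  rewrite actE; have : (w *m B <= row_base B)%MS by rewrite eq_row_base submxMl.
  by case/submxP => c ->; exists c => //; rewrite lcE.
Qed.

End Affords.

End Modules.

(** The products of a [K]-basis of [R] with the generators span [M] over [K], so [M] has a finite
    basis; the action of [r] on it defines [X r]. *)
Lemma affords_exist (K : fieldType) (R : falgType K) (M : lmodType R) :
  finitely_generated M ->
  exists d (b : 'I_d -> M) (X : R -> 'M[K]_d), affords b X.
Proof.
case=> n [g gspan].
pose rb := vbasis (fullv : {vspace R}).
pose v (p : 'I_#|{: 'I_n * 'I_(\dim (fullv : {vspace R}))}|) : Defs.over M :=
  rb`_(enum_val p).2 *: (g (enum_val p).1 : M).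
have [|d [b [_ binj bsurj]]] := @has_dim_span K (Defs.over M) _ v.
  move=> x; have [c ->] := gspan x.
  exists (fun p => coord rb (enum_val p).2 (c (enum_val p).1)).
  rewrite -(big_enum_val (A := predT)
    (fun p => coord rb p.2 (c p.1) *: (rb`_p.2 *: g p.1 : Defs.over M))) /=.
  rewrite -(pair_big xpredT xpredT
    (fun i j => coord rb j (c i) *: (rb`_j *: g i : Defs.over M))) /=.
  apply: eq_bigr => i _; rewrite {1}(coord_vbasis (memvf (c i))) scaler_suml.
  apply: eq_bigr => j _.
  by rewrite -[RHS]/(_%:A *: (_ *: _)) scalerA -scalerAl mul1r.
have {}binj : injective (lincomb (b : 'I_d -> M)).
  by move=> u u' uu'; apply: binj; rewrite ?inE.
have {}bsurj x : exists u, x = lincomb (b : 'I_d -> M) u.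
  by have [u _ <-] := bsurj x I; exists u.
have /choice[X XE] : forall r, exists A : 'M[K]_d, forall i,
    r *: (b i : M) = lincomb (b : 'I_d -> M) (row i A).
  move=> r; have /choice[u uE] : forall i, exists u,
      r *: (b i : M) = lincomb (b : 'I_d -> M) u by move=> i; apply: bsurj.
  by exists (\matrix_i u i) => i; rewrite rowK.
exists d, b, X; split=> // r u; rewrite lincombMmx scaler_sumr.
apply: eq_bigr => i _; rewrite -XE !scalerA; congr (_ *: _).
by rewrite -scalerAr mulr1 -scalerAl mul1r.
Qed.

(** * Frames from direct sums of modules *)

Section MultisumFrame.
Variables (K : fieldType) (R : algType K) (t : nat).
Variables (N : 'I_t -> lmodType R) (alpha : 'I_t -> nat).

Definition summand (i : 'I_t) (a : 'I_(alpha i)) (x : N i) : multisum N alpha :=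
  dfwith (fun i => 0 : {ffun 'I_(alpha i) -> N i})
    ([ffun a' => if a' == a then x else 0] : {ffun 'I_(alpha i) -> N i}).

Lemma summand_linear i a (r : R) (x y : N i) :
  summand a (r *: x + y) = r *: summand a x + summand a y.
Proof.
apply: functional_extensionality_dep => j.
rewrite -[RHS]/(r *: summand a x j + summand a y j) /summand.
have [<-|ij] := eqVneq i j; last by rewrite !dfwith_out // scaler0 addr0.
rewrite !dfwith_in; apply/ffunP => a'; rewrite !ffunE.
by case: eqP => // _; rewrite scaler0 addr0.
Qed.

Lemma summand0 i a : @summand i a 0 = 0.
Proof.
have := summand_linear a 1 (0 : N i) 0.
rewrite !scale1r addr0 => /(congr1 (fun x => x - summand a (0 : N i))).
by rewrite subrr addrK.
Qed.

Lemma summand_sum I (s : seq I) i a (c : I -> R) (x : I -> N i) :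
  summand a (\sum_(k <- s) c k *: x k) = \sum_(k <- s) c k *: summand a (x k).
Proof.
elim/big_rec2: _ => [|k y z _ <-]; first exact: summand0.
exact: summand_linear.
Qed.

Lemma dprodE_sum (A : pzRingType) (I J : Type) (V : I -> lmodType A) (s : seq J)
    (F : J -> dprod V) i : (\sum_(k <- s) F k) i = \sum_(k <- s) F k i.
Proof. by elim/big_rec2: _ => [//|k x y _ <-]. Qed.

Lemma sum_summandE (x : forall i, 'I_(alpha i) -> N i) j a :
  (\sum_i \sum_b summand b (x i b)) j a = x j a.
Proof.
rewrite dprodE_sum sum_ffunE (bigD1 j) //= [X in _ + X]big1 ?addr0 => [|i ij].
  rewrite dprodE_sum sum_ffunE (bigD1 a) //= [X in _ + X]big1 ?addr0 => [|b ba].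
    by rewrite /summand dfwith_in ffunE eqxx.
  by rewrite /summand dfwith_in ffunE eq_sym (negbTE ba).
rewrite dprodE_sum sum_ffunE big1 // => b _.
by rewrite /summand dfwith_out // ffunE.
Qed.

Lemma multisum_decomp (x : multisum N alpha) : x = \sum_i \sum_a summand a (x i a).
Proof.
apply: functional_extensionality_dep => i; apply/ffunP => a.
by rewrite sum_summandE.
Qed.

Variables (e : 'I_t -> nat) (nb : forall i, 'I_(e i) -> N i).
Variables (Y : forall i, R -> 'M[K]_(e i)).
Hypothesis nY : forall i, affords (nb (i := i)) (Y i).
Variables (M : lmodType R) (f : {linear multisum N alpha -> M}) (P : set M).
Hypothesis fP : set_bij [set: multisum N alpha] P f.

Let w i (a : 'I_(alpha i)) l : M := f (summand a (nb l)).

Let f_summand i (a : 'I_(alpha i)) u :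
  f (summand a (lincomb (nb (i := i)) u)) = \sum_l (u 0 l)%:A *: w a l.
Proof.
rewrite /lincomb summand_sum linear_sum; apply: eq_bigr => l _.
exact: linearZ.
Qed.

(** The images under [f] of the basis vectors of all summands span [P]. With a lower bound on the
    dimension of [P] this shows that the frame fills most of [M]. *)
Lemma multisum_dim_le : (dimK P <= \sum_i alpha i * e i)%N.
Proof.
pose T := {i : 'I_t & 'I_(alpha i) * 'I_(e i)}%type.
have <- : #|{: T}| = (\sum_i alpha i * e i)%N.
  rewrite card_tagged sumnE big_map big_enum.
  by apply: eq_bigr => i _; rewrite card_prod !card_ord.
apply: (vdim_le (v := fun p : T => w (tagged p).1 (tagged p).2 : Defs.over M)).
move=> y Py; have [_ _ /(_ y Py)[x _ <-]] := fP.
have xE i (a : 'I_(alpha i)) : exists u, x i a = lincomb (nb (i := i)) u.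
  by case: (nY i).
pose u i (a : 'I_(alpha i)) := projT1 (cid (xE i a)).
have uE i a : x i a = lincomb (nb (i := i)) (u i a) by exact: projT2 (cid (xE i a)).
exists (fun p : T => u (tag p) (tagged p).1 0 (tagged p).2).
rewrite {1}[x]multisum_decomp linear_sum.
transitivity (\sum_i \sum_(p : 'I_(alpha i) * 'I_(e i))
    ((u i p.1 0 p.2)%:A *: w p.1 p.2 : M)).
  apply: eq_bigr => i _; rewrite linear_sum -(pair_big xpredT xpredT (fun a l =>
     (u i a 0 l)%:A *: w a l : M)) /=.
  apply: eq_bigr => a _.
  by rewrite uE f_summand.
by rewrite sig_big_dep.
Qed.

Variables (d : nat) (b : 'I_d -> M) (X : R -> 'M[K]_d).
Hypothesis bX : affords b X.

(** Composing [f] with the inclusion of a summand embeds [N i] into [M]; injectivity of [f] makes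
    the sum of these embeddings direct. *)
Lemma multisum_frame : frame X Y alpha.
Proof.
have [binj bsurj bXE] := bX; have [_ finj _] := fP.
have /choice[co coE] := bsurj.
pose v i (a : 'I_(alpha i)) : 'M[K]_(e i, d) := \matrix_l co (w a l).
have vE i a u : lincomb b (u *m v i a) = f (summand a (lincomb (nb (i := i)) u)).
  by rewrite lincombMmx f_summand; apply: eq_bigr => l _; rewrite rowK -coE.
exists (fun i a => if insub a is Some a' then v i a' else 0); split.
  move=> i a r ai; rewrite -[a]/(val (Ordinal ai)) valK.
  set a' := Ordinal ai; apply/row_matrixP => l; rewrite !rowE; apply: binj.
  rewrite !mulmxA -bXE !vE -linearZ; congr (f _).
  have [_ _ nYE] := nY i; rewrite -nYE.
  have /esym := summand_linear a' r (lincomb (nb (i := i)) (delta_mx 0 l)) 0.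
  by rewrite summand0 !addr0.
move=> c c0; have {}c0 : \sum_i \sum_(a < alpha i) c i a *m v i a = 0.
  rewrite -[RHS]c0; apply: eq_bigr => i _; apply: eq_bigr => a _.
  by rewrite valK.
have {}c0 : \sum_i \sum_(a < alpha i) summand a (lincomb (nb (i := i)) (c i a)) = 0.
  apply: finj; rewrite ?inE // linear0 -[RHS](lincomb0 b) -c0 lincomb_sum linear_sum.
  apply: eq_bigr => i _; rewrite lincomb_sum linear_sum.
  by apply: eq_bigr => a _; rewrite vE.
move=> i a ai; have [ninj _ _] := nY i; apply: ninj; rewrite lincomb0.
have := sum_summandE
  (fun i (a : 'I_(alpha i)) => lincomb (nb (i := i)) (c i a)) (Ordinal ai).
by rewrite c0 /= => <-; rewrite ffunE.
Qed.

End MultisumFrame.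

(** * Choice of the subsequence *)

Definition unbounded (S : set nat) : Prop := forall n, exists2 m, (n <= m)%N & S m.

(** If every colour occurred only boundedly often in [S], an element of [S] beyond all the bounds
    could have no colour. *)
Lemma pigeonhole_unbounded (T : finType) (b : nat -> T) (S : set nat) :
  unbounded S -> exists2 S', unbounded S' /\ S' `<=` S &
    forall m n, S' m -> S' n -> b m = b n.
Proof.
move=> Sinf.
have [c cinf] : exists c, unbounded [set m | S m /\ b m = c].
  apply: contrapT => /forallNP noc.
  have /choice[n nE] : forall c, exists n, forall m, (n <= m)%N -> ~ (S m /\ b m = c).
    move=> c; have /existsNP[n Hn] := noc c; exists n => m nm Hm.
    by apply: Hn; exists m.
  have [m mn Sm] := Sinf (\max_c n c)%N.
  by apply: (nE (b m) m); rewrite ?(leq_trans _ mn) ?leq_bigmax.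
by exists [set m | S m /\ b m = c]; [split=> // m []|move=> m n [_ ->] [_ ->]].
Qed.

(** The unbounded sets [Q j] decrease, and [b j] is constant on [Q j.+1], which contains both [n j]
    and [n j.+1]. The bound [j <= n j] preserves limits along [n]. *)
Lemma coloured_subsequence (T : nat -> finType) (b : forall j, nat -> T j) :
  exists n : nat -> nat, forall j, (j <= n j)%N /\ b j (n j) = b j (n j.+1).
Proof.
pose U := {S | unbounded S}.
have step j (S : U) : exists S' : U, sval S' `<=` sval S /\
    forall m n, sval S' m -> sval S' n -> b j m = b j n.
  have [S' [S'inf S'S] bS'] := pigeonhole_unbounded (b j) (proj2_sig S).
  by exists (exist _ S' S'inf).
have T_inf : unbounded setT by move=> n; exists n.
pose next j S : U := sval (cid (step j S)).
pose Q := fix Q j : U := if j is j'.+1 then next j' (Q j') else exist _ setT T_inf.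
have QS j : sval (Q j.+1) `<=` sval (Q j) by case: (svalP (cid (step j (Q j)))).
have Qb j m n : sval (Q j.+1) m -> sval (Q j.+1) n -> b j m = b j n.
  by case: (svalP (cid (step j (Q j)))) => _; apply.
have /choice[n nQ] : forall j, exists m, (j <= m)%N /\ sval (Q j.+1) m.
  by move=> j; have [m] := proj2_sig (Q j.+1) j; exists m.
exists n => j; have [jn Qn] := nQ j; split => //; apply: Qb => //.
by apply: QS; case: (nQ j.+1).
Qed.

(** * Comparison of two fillings *)

Section Close.
Variables (K : fieldType) (R : Type).

(* Up to a proportion [2 * delta], both spaces are filled by the same modules in
   the same proportions. *)
Definition packs_alike (delta : rat) d (X : R -> 'M[K]_d)
    d' (X' : R -> 'M[K]_d') : Prop :=
  exists t (e : 'I_t -> nat) (Y : forall i, R -> 'M[K]_(e i)) alpha alpha',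
    [/\ frame X Y alpha, frame X' Y alpha' &
     1 - 2 * delta <= \sum_i Num.min ((alpha i * e i)%:R / d%:R)
                                     ((alpha' i * e i)%:R / d'%:R)].

(** This is the bound of [frame_common] for a frame and itself, evaluated at [r]. *)
Lemma frame_dim d (X : R -> 'M[K]_d) t e (Y : forall i : 'I_t, R -> 'M[K]_(e i)) beta :
  R -> frame X Y beta -> (\sum_i beta i * e i <= d)%N.
Proof.
move=> r HX; have [g _ /(_ r)] := frame_common HX HX.
exact: leq_trans (leq_addl _ _).
Qed.

(** [S] contains [q * al i] copies of the type [Y i] and [S'] contains [q' * al' i]. The smaller
    numbers give a common frame of dimension at least [(1 - delta) * (1 - 2 * delta) * N], to which
    [frame_common] applies. *)
Lemma close_conj (delta : rat) d (X : R -> 'M[K]_d) d' (X' : R -> 'M[K]_d')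
    N q q' (S S' : R -> 'M[K]_N) :
  (0 < d)%N -> (0 < d')%N -> 0 <= delta <= 1 -> packs_alike delta X X' ->
  copies X q S -> copies X' q' S' ->
  (1 - delta) * N%:R <= (q * d)%:R -> (1 - delta) * N%:R <= (q' * d')%:R ->
  exists2 g : 'M_N, g \in unitmx & forall r,
    (\rank (S r - g *m S' r *m invmx g))%:R <= 3 * delta * N%:R.
Proof.
move=> d0 d'0 /andP[de0 de1] [t [e [Y [al [al' [fX fX' alE]]]]]] cS cS' qd qd'.
pose ga i := minn (q * al i) (q' * al' i).
have fS : frame S Y ga.
  by apply: frame_sub (copies_frame cS fX) => i; apply: geq_minl.
have fS' : frame S' Y ga.
  by apply: frame_sub (copies_frame cS' fX') => i; apply: geq_minr.
have [g gU gE] := frame_common fS fS'; exists g => // r.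
have de1' : 0 <= 1 - delta by rewrite subr_ge0.
have scale a b c f : (0 < b)%N -> (1 - delta) * N%:R <= (c * b)%:R ->
    (1 - delta) * N%:R * ((a * f)%:R / b%:R) <= (c * a * f)%:R :> rat.
  move=> b0 cb; have -> : (c * a * f)%:R = (c * b)%:R * ((a * f)%:R / b%:R) :> rat.
    by rewrite !natrM; field; rewrite pnatr_eq0 -lt0n.
  by rewrite ler_wpM2r // divr_ge0.
have gaE : (1 - delta) * N%:R * (1 - 2 * delta) <= (\sum_i ga i * e i)%:R.
  apply: (@le_trans _ _ ((1 - delta) * N%:R * \sum_i
      Num.min ((al i * e i)%:R / d%:R) ((al' i * e i)%:R / d'%:R))).
    by rewrite ler_wpM2l // mulr_ge0.
  rewrite mulr_sumr natr_sum; apply: ler_sum => i _.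
  rewrite /ga minnMl; case: (leqP (q * al i * e i) (q' * al' i * e i)) => _.
    by apply: le_trans (scale _ _ _ _ d0 qd); rewrite ler_wpM2l ?mulr_ge0 // ge_min lexx.
  by apply: le_trans (scale _ _ _ _ d'0 qd');
    rewrite ler_wpM2l ?mulr_ge0 // ge_min lexx orbT.
have := gE r; rewrite -(ler_nat rat) natrD.
have N0 : 0 <= N%:R :> rat by [].
(* Since [(1 - delta) * (1 - 2 * delta) >= 1 - 3 * delta], at most [3 * delta * N] remains for the
   rank. *)
set rk := _%:R; set sg := _%:R in gaE *; nra.
Qed.

(** Indices are coloured by the proportions of the [t j] types, rounded down to multiples of
    [1 / (2 ^ j * t j)]. For equal colours the rounding costs at most [2 ^- j] in total, on top of
    the share [2 ^- j] that the types leave uncovered. *)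
Lemma close_subsequence (r0 : R) (d : nat -> nat) (X : forall n, R -> 'M[K]_(d n)) :
  (forall n, (0 < d n)%N) ->
  (forall j, exists t (e : 'I_t -> nat) (Y : forall i, R -> 'M[K]_(e i)),
    forall n, exists2 alpha, frame (X n) Y alpha &
      (2 ^ j * d n <= 2 ^ j * (\sum_i alpha i * e i) + d n)%N) ->
  exists n : nat -> nat, forall j, (j <= n j)%N /\
    packs_alike (2 ^+ j)^-1 (X (n j)) (X (n j.+1)).
Proof.
move=> d0 H.
pose t j := projT1 (cid (H j)).
pose e j : 'I_(t j) -> nat := projT1 (cid (projT2 (cid (H j)))).
pose Y j : forall i, R -> 'M_(e j i) := projT1 (cid (projT2 (cid (projT2 (cid (H j)))))).
have HY j n : exists al, frame (X n) (Y j) al /\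
   (2 ^ j * d n <= 2 ^ j * (\sum_i al i * e j i) + d n)%N.
  have [al ? ?] := projT2 (cid (projT2 (cid (projT2 (cid (H j)))))) n.
  by exists al.
pose al j n := projT1 (cid (HY j n)).
have alF j n : frame (X n) (Y j) (al j n) by case: (projT2 (cid (HY j n))).
have alE j n : (2 ^ j * d n <= 2 ^ j * (\sum_i al j n i * e j i) + d n)%N.
  by case: (projT2 (cid (HY j n))).
(* No proportion exceeds 1, so the rounded values are at most [2 ^ j * t j] and [inord] does not
   truncate. *)
pose b j n : {ffun 'I_(t j) -> 'I_(2 ^ j * t j).+1} :=
  [ffun i => inord ((al j n i * e j i * (2 ^ j * t j)) %/ d n)].
have [n nE] := coloured_subsequence b; exists n => j.
have [jn bE] := nE j; split=> //.
exists (t j), (e j), (Y j), (al j (n j)), (al j (n j.+1)); split => //.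
pose x m i : rat := (al j m i * e j i)%:R / (d m)%:R.
have dr0 m : 0 < (d m)%:R :> rat by rewrite ltr0n.
have j0 : 0 < 2 ^+ j :> rat by rewrite exprn_gt0.
have sx m : 1 - (2 ^+ j)^-1 <= \sum_i x m i.
  have := alE j m; rewrite -(ler_nat rat) natrD !natrM natrX.
  rewrite /x -mulr_suml -natr_sum; set s := (\sum_i _)%:R => Hs.
  rewrite ler_pdivlMr // -(ler_pM2l j0).
  by rewrite mulrA mulrBr mulr1 divff ?gt_eqF // mulrBl mul1r lerBlDr.
have xle m i : (al j m i * e j i <= d m)%N.
  by apply: leq_trans (frame_dim r0 (alF j m)); rewrite (bigD1 i) //= leq_addr.
(* Two numbers with the same integer part after scaling by [2 ^ j * t j] differ by at most the
   inverse of that scale. *)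
have xx i : x (n j) i <= x (n j.+1) i + (2 ^ j * t j)%:R^-1.
  have t0 : (0 < t j)%N by case: (t j) i => [[]|].
  have m0 : 0 < (2 ^ j * t j)%:R :> rat by rewrite ltr0n muln_gt0 expn_gt0.
  have /ffunP/(_ i)/(congr1 val) := bE; rewrite !ffunE.
  have dvle m : ((al j m i * e j i * (2 ^ j * t j)) %/ d m < (2 ^ j * t j).+1)%N.
    rewrite ltn_divLR // mulSn mulnC (leq_ltn_trans (leq_mul (leqnn _) (xle m i))) //.
    by rewrite -[ltnLHS]add0n ltn_add2r.
  rewrite /= !inordK //; set w := (2 ^ j * t j)%N in m0 *.
  rewrite /x; set A := (al j (n j) i * _)%N; set B := (al j _ i * _)%N => AB.
  have HA : (A * w < ((B * w) %/ d (n j.+1)).+1 * d (n j))%N by rewrite -AB ltn_ceil.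
  have HB : ((B * w) %/ d (n j.+1) * d (n j.+1) <= B * w)%N by apply: leq_trunc_div.
  move: w A B m0 HA HB {AB dvle} => w A B m0 HA HB.
  move: HA HB; rewrite -(ltr_nat rat) -(ler_nat rat) !natrM -natr1.
  set z := (_ %/ _)%:R => HA HB.
  rewrite -(ler_pM2r m0) mulrDl mulVf ?gt_eqF //.
  apply: (@le_trans _ _ (z + 1)).
    by rewrite mulrAC ler_pdivrMr //; exact: ltW.
  by rewrite lerD2r mulrAC ler_pdivlMr.
have mx i : x (n j) i - (2 ^ j * t j)%:R^-1 <= Num.min (x (n j) i) (x (n j.+1) i).
  by rewrite le_min lerBlDr lerDl invr_ge0 ler0n /= lerBlDr.
apply: le_trans (ler_sum _ (fun i _ => mx i)); rewrite sumrB.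
have := sx (n j); rewrite sumr_const card_ord.
suff : (2 ^ j * t j)%:R^-1 *+ t j <= (2 ^+ j)^-1 :> rat by move=> *; lra.
(* Without types the sum of errors is empty; otherwise [t j] errors of size [1 / (2 ^ j * t j)] add
   up to [2 ^- j]. *)
case: (t j) => [|u]; first by rewrite mulr0n invr_ge0 ltW.
rewrite -[leLHS]mulr_natr natrM natrX invfM -mulrA mulVf ?pnatr_eq0 //.
by rewrite mulr1.
Qed.

End Close.

(** * Almost representations at the stages of the direct limit *)

Section StageSequence.
Variable K : fieldType.

Lemma dblB k (A B : 'M[K]_(2 ^ k)) : dbl (A - B) = dbl A - dbl B.
Proof. by rewrite dblD -scaleN1r dblZ scaleN1r. Qed.

Lemma tr_dbl k (A : 'M[K]_(2 ^ k)) : (dbl A)^T = dbl A^T.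
Proof.
rewrite /dbl; case: _ / (dbl_size k); rewrite !castmx_id.
by rewrite tr_block_mx !trmx0.
Qed.

Lemma rank_blk_dbl k l m (F : 'I_k -> 'I_l -> 'M[K]_(2 ^ m)) :
  \rank (blk (fun i j => dbl (F i j))) = (2 * \rank (blk F))%N.
Proof.
rewrite mul2n -addnn -rank_blk_block /dbl; case: _ / (dbl_size m).
by under eq_blk do rewrite castmx_id.
Qed.

(** The thread of [A] started at stage [k]: zero before that stage, repeated doubling after it. At
    stage [k] itself [conform_mx] only changes the type of [A]. *)
Fixpoint extend k (A : 'M[K]_(2 ^ k)) m : 'M[K]_(2 ^ m) :=
  if m is m'.+1 then if k == m'.+1 then conform_mx 0 A else dbl (extend A m')
  else conform_mx 0 A.

Lemma extend_id k (A : 'M[K]_(2 ^ k)) : extend A k = A.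
Proof. by case: k A => [|k] A /=; rewrite ?eqxx conform_mx_id. Qed.

Lemma extendS k (A : 'M[K]_(2 ^ k)) m : (k <= m)%N ->
  extend A m.+1 = dbl (extend A m).
Proof. by move=> km /=; rewrite ltn_eqF. Qed.

Variables (R : Type) (d : nat -> nat) (X : forall j, R -> 'M[K]_(d j)).

Definition follows k (T : R -> stages K) : Prop :=
  forall m, (k <= m)%N -> forall r, T r m.+1 = dbl (T r m).

(* The rows give antihomomorphisms; transposing makes [T] a homomorphism. *)
Definition padded j (T : R -> stages K) m : Prop :=
  exists2 q, copies (X j) q (fun r => (T r m)^T) &
    (1 - (2 ^+ j)^-1) * (2 ^ m)%:R <= (q * d j)%:R :> rat.

(** Doubling doubles both the number of copies and the size, so the filled proportion persists. *)
Lemma padded_follows j k T : follows k T -> padded j T k ->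
  forall m, (k <= m)%N -> padded j T m.
Proof.
move=> fT pT m km; rewrite -(subnK km); elim: (m - k)%N => [//|p [q cq qb]].
exists (q + q)%N; last by rewrite addSn expnS mul2n -addnn mulnDl !natrD mulrDr lerD.
rewrite addSn; have -> : (fun r => (T r (p + k).+1)^T) =
    fun r => castmx (dbl_size (p + k), dbl_size (p + k))
      (block_mx (T r (p + k)%N)^T 0 0 (T r (p + k)%N)^T).
  by apply/funext => r; rewrite fT ?leq_addl // tr_dbl.
exact: copies_cast (copies_sum cq cq).
Qed.

Definition approximates j (T : R -> stages K) : Prop :=
  exists k, forall m, (k <= m)%N -> (forall r, T r m.+1 = dbl (T r m)) /\ padded j T m.

Lemma approximates_extend j k (S : R -> 'M[K]_(2 ^ k)) q : copies (X j) q S ->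
  (1 - (2 ^+ j)^-1) * (2 ^ k)%:R <= (q * d j)%:R :> rat ->
  approximates j (fun r => extend (S r)^T).
Proof.
move=> cS qb; have fT : follows k (fun r => extend (S r)^T : stages K).
  by move=> m km r; apply: extendS.
exists k => m km; split; first exact: fT.
apply: padded_follows fT _ _ km; exists q => //.
by under eq_fun do rewrite extend_id trmxK.
Qed.

Hypothesis d0 : forall j, (0 < d j)%N.

Lemma packing j k0 : exists k q, [/\ (k0 <= k)%N, (q * d j <= 2 ^ k)%N &
  (1 - (2 ^+ j)^-1) * (2 ^ k)%:R <= (q * d j)%:R :> rat].
Proof.
(* This exponent gives [2 ^ j * d j <= 2 ^ k], so the remainder of the division, being less than
   [d j], is at most a proportion [2 ^- j] of the whole. *)
pose k := maxn k0 (j + d j); exists k, (2 ^ k %/ d j)%N; split.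
- exact: leq_maxl.
- exact: leq_trunc_div.
have : (2 ^ j * d j <= 2 ^ k)%N.
  rewrite (leq_trans _ (leq_pexp2l _ (leq_maxr k0 (j + d j)))) // expnD leq_mul2l.
  by rewrite ltnW ?orbT // ltn_expl.
have := ltn_ceil (2 ^ k) (d0 j); rewrite mulSnr -(ltr_nat rat) -(ler_nat rat).
rewrite natrD natrM [in X in _ -> X]natrM !natrX => H1 H2.
have j0 : 0 < 2 ^+ j :> rat by rewrite exprn_gt0.
have H3 : (d j)%:R <= (2 ^+ j)^-1 * 2 ^+ k :> rat by rewrite ler_pdivlMl.
by rewrite mulrBl mul1r lerBlDr (le_trans (ltW H1)) // lerD2l.
Qed.

Lemma approximates_start j : exists T, approximates j T.
Proof.
have [k [q [_ qk qb]]] := packing j 0.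
have [S cS] := copies_exist (X j) qk.
by exists (fun r => extend (S r)^T); apply: approximates_extend cS qb.
Qed.

Definition rank_near j (T T' : R -> stages K) : Prop :=
  exists k, forall m, (k <= m)%N -> forall r,
    (\rank (T r m - T' r m))%:R <= 3 * (2 ^+ j)^-1 * (2 ^ m)%:R :> rat.

(** A filling by copies of [X j.+1] remains one after conjugation, and [close_conj] supplies a
    conjugation that brings it near [T] at one stage. Doubling carries the bound on the normalized
    rank to all later stages. *)
Lemma approximates_step j T :
  packs_alike (2 ^+ j)^-1 (X j) (X j.+1) -> approximates j T ->
  exists T', approximates j.+1 T' /\ rank_near j T T'.
Proof.
move=> clX [k0 gT]; have [k [q [k0k qk qb]]] := packing j.+1 k0.
have [S cS] := copies_exist (X j.+1) qk.
have [_ [p cp pb]] := gT k k0k.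
have j0 : 0 < 2 ^+ j :> rat by rewrite exprn_gt0.
have [||g gU gE] := close_conj (d0 j) (d0 j.+1) _ clX cp cS pb _.
- by rewrite invr_ge0 ltW //= invf_le1 // exprn_ege1 // ler1n.
(* The filling, made at precision [j.+1], is used here at the weaker precision [j]. *)
- apply: le_trans qb; rewrite ler_wpM2r // lerD2l lerN2 lef_pV2 ?posrE ?exprn_gt0 //.
  by rewrite ler_weXn2l ?ler1n.
exists (fun r => extend (g *m S r *m invmx g)^T).
split; first exact: approximates_extend (copies_conj gU cS) qb.
exists k => m km r; rewrite -(subnK km); elim: (m - k)%N => [|i IH].
  by rewrite extend_id -mxrank_tr linearB /= trmxK gE.
rewrite addSn (proj1 (gT _ _)) ?extendS ?leq_addl ?(leq_trans k0k) ?leq_addl //.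
by rewrite -dblB mxrank_dbl expnS !natrM mulrCA ler_pM2l // ltr0n.
Qed.

Lemma approximates_sequence : (forall j, packs_alike (2 ^+ j)^-1 (X j) (X j.+1)) ->
  exists T : nat -> R -> stages K,
    forall j, approximates j (T j) /\ rank_near j (T j) (T j.+1).
Proof.
move=> clX; pose next j (s : {T | approximates j T}) : {T | approximates j.+1 T} :=
  let c := cid (approximates_step (clX j) (svalP s)) in
  exist _ (sval c) (proj1 (svalP c)).
pose Q := fix Q j : {T | approximates j T} :=
  if j is j'.+1 then next j' (Q j') else cid (approximates_start 0).
exists (fun j => sval (Q j)) => j; split; first exact: svalP.
exact: (proj2 (svalP (cid (approximates_step (clX j) (svalP (Q j)))))).
Qed.

End StageSequence.

(** * Passage to the limit *)

(** Applied over the rationals to the rank metric and over the reals to the final limit. *)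
Lemma half_power_small (F : archiRealFieldType) (eps : F) : 0 < eps ->
  exists N, forall n, (N <= n)%N -> (2 ^+ n)^-1 < eps.
Proof.
move=> e0; exists (Num.bound eps^-1) => n Nn.
rewrite invf_plt ?posrE ?exprn_gt0 //.
have ei0 : 0 <= eps^-1 by rewrite invr_ge0 ltW.
rewrite (lt_le_trans (archi_boundP ei0)) //.
by rewrite -natrX ler_nat (leq_trans Nn) // ltnW // ltn_expl.
Qed.

(** * Rank estimates in the direct limit *)

Section DirlimRank.
Variable K : fieldType.

Lemma dl_pi_eq (a b : thread K) :
  (exists N, forall m, (N <= m)%N -> val a m = val b m) -> dl_pi a = dl_pi b.
Proof.
move=> [N ab]; apply/aq_piE/ev_zeroP; exists N => // m /= Nm.
by rewrite -[LHS]/(val a m - val b m) ab ?subrr.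
Qed.

Lemma dl_norm_piP (a : thread K) : exists N, forall m, (N <= m)%N ->
  dl_norm (dl_pi a) = (\rank (val a m))%:R / (2 ^ m)%:R.
Proof. by have [N _ aN] := dl_norm_pi a; exists N => m; apply: aN. Qed.

(** There are finitely many entries, so from one stage [N] on all of them follow [dbl] and agree
    with the representatives chosen by [aq_repr]. The normalized rank is then constant, hence it is
    the value selected by [xget]. *)
Lemma dl_rank_piP k l (a : 'I_k -> 'I_l -> thread K) : exists N, forall m, (N <= m)%N ->
  dl_rank (\matrix_(i, j) dl_pi (a i j)) =
  (\rank (blk (fun i j => val (a i j) m)))%:R / (2 ^ m)%:R.
Proof.
have aS i j : exists N, forall m, (N <= m)%N -> val (a i j) m.+1 = dbl (val (a i j) m).
  by have /coherentP[N _ aN] := valP (a i j); exists N => m; apply: aN.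
have aR i j : exists N, forall m, (N <= m)%N ->
    val (aq_repr (dl_pi (a i j))) m = val (a i j) m.
  have /aq_piE/ev_zeroP[N _ HN] : dl_pi (aq_repr (dl_pi (a i j))) = dl_pi (a i j).
    exact: aq_reprK.
  by exists N => m Nm; apply/eqP; rewrite -subr_eq0; apply/eqP; apply: HN.
pose N := \max_i \max_j maxn (projT1 (cid (aS i j))) (projT1 (cid (aR i j))).
have leN i j : (maxn (projT1 (cid (aS i j))) (projT1 (cid (aR i j))) <= N)%N.
  apply: leq_trans (leq_bigmax (F := fun i => \max_j _) i).
  exact: (leq_bigmax (F := fun j => maxn _ _) j).
have aSN i j m : (N <= m)%N -> val (a i j) m.+1 = dbl (val (a i j) m).
  move=> Nm; apply: (projT2 (cid (aS i j))); apply: leq_trans Nm.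
  by apply: leq_trans (leN i j); apply: leq_maxl.
have aRN i j m : (N <= m)%N -> val (aq_repr (dl_pi (a i j))) m = val (a i j) m.
  move=> Nm; apply: (projT2 (cid (aR i j))); apply: leq_trans Nm.
  by apply: leq_trans (leN i j); apply: leq_maxr.
pose r m : rat := (\rank (blk (fun i j => val (a i j) m)))%:R / (2 ^ m)%:R.
have rN m : (N <= m)%N -> r m = r N.
  move=> Nm; rewrite -(subnK Nm); elim: (m - N)%N => [//|p <-].
  rewrite addSn /r; have /eq_blk -> : forall i j, val (a i j) (p + N).+1 =
      dbl (val (a i j) (p + N)%N) by move=> i j; rewrite aSN ?leq_addl.
  rewrite rank_blk_dbl expnS !natrM invfM mulrACA divff ?pnatr_eq0 //.
  by rewrite mul1r.
have sN m : (N <= m)%N -> (\rank (stage_mx (\matrix_(i, j) dl_pi (a i j)) m))%:R /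
    (2 ^ m)%:R = r m :> rat.
  move=> Nm; congr (_%:R / _); congr (\rank _); apply: eq_mxblock => i j.
  by rewrite mxE aRN.
exists N => m Nm; rewrite -/(r m); apply: xget_subset1.
  by exists N => // p /= Np; rewrite sN // rN // rN.
move=> q q' [N1 _ H1] [N2 _ H2].
by rewrite -(H1 (maxn N1 N2) (leq_maxl _ _)) -(H2 (maxn N1 N2) (leq_maxr _ _)).
Qed.

(** At a common stage [A] is the sum of [B] and the difference, whose block matrix has rank at most
    the sum of the ranks of its blocks. *)
Lemma dl_rank_le k l (A B : 'M[dirlim K]_(k, l)) :
  dl_rank A <= dl_rank B + \sum_i \sum_j dl_norm (A i j - B i j).
Proof.
pose a i j := aq_repr (A i j); pose b i j := aq_repr (B i j).
have AE : A = \matrix_(i, j) dl_pi (a i j).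
  by apply/matrixP => i j; rewrite mxE [RHS]aq_reprK.
have BE : B = \matrix_(i, j) dl_pi (b i j).
  by apply/matrixP => i j; rewrite mxE [RHS]aq_reprK.
have ABE i j : A i j - B i j = dl_pi (a i j - b i j).
  rewrite AE BE !mxE -scaleN1r -[_ *: _]aq_piZ -[_ + _]aq_piD.
  by congr (dl_pi (_ + _)); rewrite scaleN1r.
have [Na HA] := dl_rank_piP a; have [Nb HB] := dl_rank_piP b.
have abN i j := dl_norm_piP (a i j - b i j).
pose N := maxn (maxn Na Nb) (\max_i \max_j projT1 (cid (abN i j))).
have abE i j : dl_norm (A i j - B i j) =
    (\rank (val (a i j) N - val (b i j) N))%:R / (2 ^ N)%:R.
  rewrite ABE (projT2 (cid (abN i j)) N) //.
  apply: leq_trans (leq_maxr _ _).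
  apply: leq_trans (leq_bigmax (F := fun i => \max_j _) i).
  exact: (leq_bigmax (F := fun j => projT1 _) j).
rewrite AE BE (HA N) ?(HB N) ?leq_max ?leqnn ?orbT // -AE -BE.
have -> : \sum_i \sum_j dl_norm (A i j - B i j) =
    (\sum_i \sum_j \rank (val (a i j) N - val (b i j) N)%R)%:R / (2 ^ N)%:R.
  rewrite natr_sum mulr_suml; apply: eq_bigr => i _.
  by rewrite natr_sum mulr_suml; apply: eq_bigr => j _.
rewrite -mulrDl -natrD ler_wpM2r ?invr_ge0 // ler_nat.
apply: leq_trans (leq_add (leqnn _) (rank_blk_le _)).
apply: leq_trans (mxrank_add _ _); rewrite -blkD.
by have /eq_blk -> : forall i j, val (b i j) N + (val (a i j) N - val (b i j) N) =
  val (a i j) N by move=> i j; rewrite addrC subrK.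
Qed.

Lemma dl_rank_dist k l (A B : 'M[dirlim K]_(k, l)) :
  `|dl_rank A - dl_rank B| <= \sum_i \sum_j dl_norm (A i j - B i j).
Proof.
rewrite ler_norml lerBlDl dl_rank_le andbT lerNl opprB lerBlDl.
under eq_bigr do under eq_bigr do rewrite -dl_normN opprB.
exact: dl_rank_le.
Qed.

End DirlimRank.

(** * The limit of the stage representations *)

Section Limit.
Variables (K : fieldType) (R : algType K) (d : nat -> nat).
Variable X : forall j, R -> 'M[K]_(d j).
Hypothesis d0 : forall j, (0 < d j)%N.
Hypothesis X_linear : forall j c r s, X j (c *: r + s) = c *: X j r + X j s.
Hypothesis X_antimul : forall j r s, X j (r * s) = X j s *m X j r.
Hypothesis X_unit : forall j, X j 1 = 1%:M.
Variable T : nat -> R -> stages K.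
Hypothesis T_approx : forall j, approximates X j (T j).
Hypothesis T_near : forall j, rank_near j (T j) (T j.+1).

Lemma T_coherent j r : T j r \in @coherent K.
Proof.
have [N HN] := T_approx j; apply/coherentP; exists N => // m /= Nm.
by case: (HN m Nm).
Qed.

Let th j r : thread K := exist _ (T j r) (T_coherent j r).

Definition stage_rep j r : dirlim K := dl_pi (th j r).

Lemma stage_rep_linear j c r s :
  stage_rep j (c *: r + s) = c *: stage_rep j r + stage_rep j s.
Proof.
rewrite /stage_rep -[c *: dl_pi _]aq_piZ -[RHS]aq_piD; apply: dl_pi_eq.
have [N HN] := T_approx j; exists N => m Nm; have [_ [q cq _]] := HN m Nm.
apply: trmx_inj; have -> := copies_linear (@X_linear j) cq c r s.
by rewrite -[in RHS]/(c *: T j r m + T j s m) linearP.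
Qed.

Lemma stage_rep_mul j r s : stage_rep j (r * s) = stage_rep j r * stage_rep j s.
Proof.
rewrite /stage_rep -[dl_pi _ * dl_pi _]aq_piM; apply: dl_pi_eq.
have [N HN] := T_approx j; exists N => m Nm; have [_ [q cq _]] := HN m Nm.
apply: trmx_inj; have -> := copies_antimul (@X_antimul j) cq r s.
by rewrite -[in RHS]/(T j r m *m T j s m) trmx_mul.
Qed.

(** The defect is the zero padding, which takes up a proportion of at most [2 ^- j]. *)
Lemma stage_rep_unit j : dl_norm (stage_rep j 1 - 1) <= (2 ^+ j)^-1.
Proof.
rewrite -dl_normN opprB.
have -> : 1 - stage_rep j 1 = dl_pi (1 - th j 1).
  rewrite -scaleN1r -[_ *: _]aq_piZ -[1](aq_pi1 (@ev_zero K : biideal _)) -[_ + _]aq_piD.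
  by congr (dl_pi (_ + _)); rewrite scaleN1r.
have [N HN] := T_approx j; have [N' HN'] := dl_norm_piP (1 - th j 1).
pose m := maxn N N'; rewrite (HN' m) ?leq_maxr //.
have [_ [q cq qb]] := HN m (leq_maxl _ _).
rewrite -[val _ m]/(1%:M - T j 1 m) -mxrank_tr linearB /= trmx1.
have := copies_unit (X_unit j) cq => /(congr1 (fun n => n%:R : rat)).
have m0 : 0 < (2 ^ m)%:R :> rat by rewrite ltr0n expn_gt0.
rewrite natrD ler_pdivrMr //; move: (\rank _)%:R (q * d j)%:R (2 ^ m)%:R qb.
by move=> x y n qb un; move: (2 ^+ j)^-1 qb => e; lra.
Qed.

Lemma stage_rep_near j r : dl_norm (stage_rep j r - stage_rep j.+1 r) <= 3 * (2 ^+ j)^-1.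
Proof.
have -> : stage_rep j r - stage_rep j.+1 r = dl_pi (th j r - th j.+1 r).
  rewrite -scaleN1r -[_ *: _]aq_piZ -[_ + _]aq_piD.
  by congr (dl_pi (_ + _)); rewrite scaleN1r.
have [N HN] := T_near j; have [N' HN'] := dl_norm_piP (th j r - th j.+1 r).
pose m := maxn N N'; rewrite (HN' m) ?leq_maxr // ler_pdivrMr ?ltr0n ?expn_gt0 //.
exact: HN (leq_maxl _ _) r.
Qed.

(** The rank over [T j] is [q] times the rank over [X j]. The normalized ranks therefore differ by
    the unfilled proportion, at most [2 ^- j], times the normalized rank over [X j], at most [l]. *)
Lemma stage_rep_rank j k l (A : 'M[R]_(k, l)) :
  `|dl_rank (\matrix_(p, q) stage_rep j (A p q)) -
    (\rank (blk (fun q p => X j (A p q))))%:R / (d j)%:R| <= l%:R * (2 ^+ j)^-1.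
Proof.
have [N HN] := T_approx j; have [N' HN'] := dl_rank_piP (fun p q => th j (A p q)).
pose m := maxn N N'; rewrite (HN' m) ?leq_maxr //.
have [_ [q cq qb]] := HN m (leq_maxl _ _).
rewrite -mxrank_tr tr_blk (copies_rank (fun q p => A p q) cq).
have : (\rank (blk (fun q p => X j (A p q))) <= l * d j)%N.
  by apply: leq_trans (rank_leq_row _) _; rewrite sum_nat_const card_ord.
have := copies_unit (X_unit j) cq => /eqP; rewrite -(eqr_nat rat) => /eqP.
set rk := \rank (blk _); rewrite natrD -(ler_nat rat) !natrM.
have m0 : 0 < (2 ^ m)%:R :> rat by rewrite ltr0n expn_gt0.
have dj0 : 0 < (d j)%:R :> rat by rewrite ltr0n.
have r0 : 0 <= rk%:R :> rat by [].
have u0 : 0 <= (\rank (1%:M - (T j 1 m)^T))%:R :> rat by [].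
rewrite natrM in qb.
move: (\rank (1%:M - _))%:R u0 => u u0; move: (2 ^+ j)^-1 qb => e.
move: (2 ^ m)%:R m0 => n n0; move: (d j)%:R dj0 => D D0; move: rk%:R r0 => x x0.
move: q%:R => Q; move: l%:R => L qb un xL.
have -> : Q * x / n - x / D = - ((1 - Q * D / n) * (x / D)).
  by field; rewrite !gt_eqF.
have e1 : 1 - Q * D / n <= e by rewrite lerBlDr -lerBlDl ler_pdivlMr.
have e0 : 0 <= 1 - Q * D / n by rewrite subr_ge0 ler_pdivrMr // mul1r; lra.
have xD : x / D <= L by rewrite ler_pdivrMr.
have xD0 : 0 <= x / D by rewrite divr_ge0 // ltW.
rewrite normrN ger0_norm; last exact: mulr_ge0.
by rewrite mulrC; apply: ler_pM.
Qed.

Lemma stage_rep_cauchy r : (fun j => stage_rep j r : dirlim K) \in @rank_cauchy K.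
Proof.
(* Telescoping: the steps [3 * 2 ^- i] for [m <= i < n] add up to [6 * (2 ^- m - 2 ^- n)]. *)
have le6 m n : (m <= n)%N ->
    dl_norm (stage_rep m r - stage_rep n r) <= 6 * ((2 ^+ m)^-1 - (2 ^+ n)^-1).
  move=> mn; rewrite -(subnK mn); elim: (n - m)%N => [|i IH].
    by rewrite !subrr dl_norm0 mulr0.
  rewrite addSn; set p := (i + m)%N in IH *.
  rewrite -(subrKA (stage_rep p r)) (le_trans (dl_normD _ _)) //.
  rewrite (le_trans (lerD IH (stage_rep_near p r))) // exprS invfM.
  by move: (2 ^+ m)^-1 (2 ^+ p)^-1 => x y; lra.
apply/rank_cauchyP => eps e0.
have [|N HN] := @half_power_small rat (eps / 6); first by rewrite divr_gt0.
have lt6 m n : (N <= m)%N -> (m <= n)%N -> dl_dist (stage_rep m r) (stage_rep n r) < eps.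
  move=> Nm mn; rewrite (le_lt_trans (le6 _ _ mn)) //.
  have := HN m Nm; have : 0 <= (2 ^+ n)^-1 :> rat by rewrite invr_ge0 exprn_ge0.
  by move: (2 ^+ m)^-1 (2 ^+ n)^-1 => x y; lra.
exists N => m n Nm Nn; case: (leqP m n) => [|/ltnW] mn; first exact: lt6.
by rewrite /dl_dist -dl_normN opprB; apply: lt6.
Qed.

Definition limit_rep r : vN_algebra K :=
  aq_pi _ (exist _ (fun j => stage_rep j r) (stage_rep_cauchy r) : cauchy_dlseq K).

Lemma limit_rep_linear c r s :
  limit_rep (c *: r + s) = c *: limit_rep r + limit_rep s.
Proof.
rewrite /limit_rep -aq_piZ -aq_piD; congr (aq_pi _ _); apply: val_inj.
by apply: funext => j; apply: stage_rep_linear.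
Qed.

Lemma limit_rep_mul r s : limit_rep (r * s) = limit_rep r * limit_rep s.
Proof.
rewrite /limit_rep -aq_piM; congr (aq_pi _ _); apply: val_inj.
by apply: funext => j; apply: stage_rep_mul.
Qed.

(** Unlike linearity and multiplicativity, this identity may fail at every stage; the defects form a
    null sequence. *)
Lemma limit_rep_unit : limit_rep 1 = 1.
Proof.
rewrite /limit_rep -aq_pi1; apply/aq_piE/rank_nullP => eps /half_power_small[N HN].
exists N => n Nn; apply: le_lt_trans (HN n Nn); exact: stage_rep_unit.
Qed.

(** Two errors add up: [aq_repr] may return another Cauchy sequence, which differs by a null
    sequence in each entry, and the stage ranks only approximate those of [X s]. *)
Lemma limit_rep_rank k l (A : 'M[R]_(k, l)) eps : 0 < eps ->
  exists N, forall s, (N <= s)%N ->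
  `|dl_rank (\matrix_(i < k, j < l) val (aq_repr (limit_rep (A i j))) s) -
    (\rank (blk (fun q p => X s (A p q))))%:R / (d s)%:R| < eps.
Proof.
(* Each of the [k * l] entries costs [eps'], and the passage to [X s] costs [l * eps']; the extra 1
   makes the total strictly smaller than [eps]. *)
move=> e0; pose eps' := eps / (k * l + l).+1%:R.
have e'0 : 0 < eps' by rewrite divr_gt0.
have HB i j : exists N, forall s, (N <= s)%N ->
    dl_norm (val (aq_repr (limit_rep (A i j))) s - stage_rep s (A i j)) < eps'.
  have /aq_piE/rank_nullP/(_ eps' e'0) [N HN] :
    aq_pi _ (aq_repr (limit_rep (A i j))) = limit_rep (A i j) := aq_reprK _.
  by exists N => s Ns; apply: HN.
have [N0 HN0] := half_power_small e'0.
exists (maxn N0 (\max_i \max_j projT1 (cid (HB i j)))) => s.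
rewrite geq_max => /andP[N0s Ns].
set B := \matrix_(_, _) _; pose C := \matrix_(i, j) stage_rep s (A i j).
rewrite -(subrKA (dl_rank C)) (le_lt_trans (ler_normD _ _)) //.
apply: (@le_lt_trans _ _ ((k * l)%:R * eps' + l%:R * eps')).
  apply: lerD.
    apply: le_trans (dl_rank_dist _ _) _.
    apply: (@le_trans _ _ (\sum_(i < k) \sum_(j < l) eps')).
      apply: ler_sum => i _; apply: ler_sum => j _; rewrite !mxE ltW //.
      apply: (projT2 (cid (HB i j))); apply: leq_trans Ns.
      apply: leq_trans (leq_bigmax (F := fun i => \max_j _) i).
      exact: (leq_bigmax (F := fun j => projT1 _) j).
    by rewrite !sumr_const !card_ord -mulrnA mulnC mulr_natl.
  apply: le_trans (stage_rep_rank _ _) _.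
  by rewrite ler_wpM2l // ltW // HN0.
rewrite -mulrDl -natrD /eps' mulrCA gtr_pMr // ltr_pdivrMr ?mul1r ?ltr_nat //.
Qed.

End Limit.

(** * From the module sequence to the representation *)

Lemma lrmorphism_exist (K : fieldType) (R A : algType K) (f : R -> A) :
  (forall c r s, f (c *: r + s) = c *: f r + f s) ->
  (forall r s, f (r * s) = f r * f s) -> f 1 = 1 ->
  exists rho : {lrmorphism R -> A}, rho =1 f.
Proof.
move=> fL fM f1.
pose fl := GRing.isLinear.Build K R A *:%R f fL.
pose fm := GRing.isMonoidMorphism.Build R A f (conj f1 fM).
pose rho : {lrmorphism R -> A} := HB.pack f fl fm.
by exists rho.
Qed.

Lemma rk_module_affords (F : numFieldType) (K : fieldType) (R : algType K)
    (M : lmodType R) d (b : 'I_d -> M) (X : R -> 'M[K]_d) k l (A : 'M[R]_(k, l)) :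
  affords b X ->
  rk_module F M A = (\rank (blk (fun q p => X (A p q))))%:R / d%:R.
Proof. by move=> bX; rewrite /rk_module (affords_rank bX) (affords_dim bX). Qed.

(** Hyperfiniteness at precision [2 ^- j], put into coordinates. Clearing denominators leaves an
    inequality between natural numbers, which is free of the field [F] and can be reused over the
    rationals. *)
Lemma hyperfinite_frames (F : realType) (K : fieldType) (R : falgType K)
    (M : nat -> lmodType R) (d : nat -> nat) (b : forall n, 'I_(d n) -> M n)
    (X : forall n, R -> 'M[K]_(d n)) :
  (forall n, affords (b n) (X n)) -> hyperfinite F M ->
  forall j, exists t (e : 'I_t -> nat) (Y : forall i, R -> 'M[K]_(e i)),
    forall n, exists2 alpha, frame (X n) Y alpha &
      (2 ^ j * d n <= 2 ^ j * (\sum_i alpha i * e i) + d n)%N.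
Proof.
move=> bX hypM j; have j0 : 0 < 2 ^+ j :> F by rewrite exprn_gt0.
have [|t [N [fgN H]]] := hypM (2 ^+ j)^-1; first by rewrite invr_gt0.
pose e i := projT1 (cid (affords_exist (fgN i))).
pose nb i : 'I_(e i) -> N i := projT1 (cid (projT2 (cid (affords_exist (fgN i))))).
pose Y i : R -> 'M[K]_(e i) :=
  projT1 (cid (projT2 (cid (projT2 (cid (affords_exist (fgN i))))))).
have nY i : affords (nb i) (Y i).
  exact: projT2 (cid (projT2 (cid (projT2 (cid (affords_exist (fgN i))))))).
exists t, e, Y => n; have [P [_ dP [al [f fP]]]] := H n.
exists al; first exact: (multisum_frame nY fP (bX n)).
rewrite -(ler_nat F) natrD !natrM natrX -lerBlDr.
rewrite (affords_dim (bX n)) in dP.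
apply: (@le_trans _ _ (2 ^+ j * (dimK P)%:R)).
  apply: le_trans (ler_wpM2l (ltW j0) dP).
  by rewrite mulrA mulrBr mulr1 divff ?gt_eqF // mulrBl mul1r.
by rewrite ler_pM2l // ler_nat; apply: (multisum_dim_le nY fP).
Qed.

Theorem theorem2 (RR : realType) (K : finFieldType) (R : falgType K)
    (M : nat -> lmodType R)
    (fgM : forall n, finitely_generated (M n))
    (nzM : forall n, nonzero_module (M n))
    (hypM : hyperfinite RR M)
    (cvgM : convergent RR M) :
  exists rho : {lrmorphism R -> vN_algebra K},
    forall (k l : nat) (A : 'M[R]_(k, l)),
      rk_rep RR rho A = rk_lim RR M A.
Proof.
pose d n := projT1 (cid (affords_exist (fgM n))).
pose b n : 'I_(d n) -> M n := projT1 (cid (projT2 (cid (affords_exist (fgM n))))).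
pose X n : R -> 'M[K]_(d n) :=
  projT1 (cid (projT2 (cid (projT2 (cid (affords_exist (fgM n))))))).
have bX n : affords (b n) (X n).
  exact: projT2 (cid (projT2 (cid (projT2 (cid (affords_exist (fgM n))))))).
(* From here on only the property [affords] is known of [d], [b] and [X]. *)
move: d b X bX => d b X bX.
have d0 n : (0 < d n)%N.
  have [x /eqP x0] := nzM n; rewrite lt0n; apply/eqP => dn.
  have [_ /(_ x)[u xu] _] := bX n; apply: x0; rewrite xu /lincomb big1 // => i.
  by have := ltn_ord i; rewrite [X in (_ < X)%N]dn.
have [n nE] := close_subsequence (0 : R) d0 (hyperfinite_frames bX hypM).
have [T TE] := approximates_sequence (fun j => d0 (n j)) (fun j => proj2 (nE j)).
have T_approx j : approximates (fun j => X (n j)) j (T j) by case: (TE j).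
have T_near j : rank_near j (T j) (T j.+1) by case: (TE j).
have XL j := affords_linear (bX (n j)); have XM j := affords_antimul (bX (n j)).
have X1 j := affords_unit (bX (n j)).
pose f := limit_rep T_approx T_near.
have [rho rhoE] := lrmorphism_exist (limit_rep_linear XL T_approx T_near)
  (limit_rep_mul XM T_approx T_near) (limit_rep_unit X1 T_approx T_near).
exists rho => k l A; rewrite /rk_rep /vN_rank; apply: cvg_lim => //.
apply/cvgrPdist_lt => eps e0.
have e20 : 0 < eps / 2 by rewrite divr_gt0.
(* The rank estimate takes a rational precision; [2 ^- N0] is one below [eps / 2]. *)
have [N0 /(_ N0 (leqnn _)) HN0] := half_power_small e20.
have q0 : 0 < (2 ^+ N0)^-1 :> rat by rewrite invr_gt0 exprn_gt0.
have [N1 HN1] := @limit_rep_rank K R _ (fun j => X (n j)) (fun j => d0 (n j)) X1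
  T T_approx T_near k l A _ q0.
have /cvgrPdist_lt/(_ _ e20)[N2 _ HN2] := cvgM k l A.
exists (maxn N1 N2) => // s /=; rewrite geq_max => /andP[N1s N2s].
(* Since [s <= n s], convergence of the whole sequence gives the estimate along [n]. *)
have := HN2 (n s) (leq_trans N2s (proj1 (nE s))).
rewrite (rk_module_affords _ _ (bX (n s))).
rewrite -/(rk_lim RR M A); move=> H2.
have := HN1 s N1s; rewrite distrC -(ltr_rat RR) ratr_norm rmorphB /= fmorph_div /=.
rewrite !ratr_nat fmorphV rmorphXn /= ratr_nat => H1.
(* The intermediate value [r] is the normalized rank of [A] on [M (n s)]. *)
set r := _ / _ in H1 H2; rewrite -(subrKA r) (le_lt_trans (ler_normD _ _)) //.
rewrite [eps]splitr ltrD // (lt_trans _ HN0) //.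
have -> : \matrix_(i < k, j < l) val (aq_repr (map_mx rho A i j)) s =
    \matrix_(i < k, j < l) val (aq_repr (f (A i j))) s.
  by apply/matrixP => i j; rewrite !mxE rhoE.
exact: H1.
Qed.
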